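(* Let $h:\mathbb{R}^n\to\mathbb{R}$ and $F:\mathbb{R}^n\to\mathbb{R}^m$ be $\mathcal{C}^2$-smooth, let $g:\mathbb{R}^m\to\overline{\mathbb{R}}$ be proper, lower semicontinuous and convex, and let $(\bar x,\bar u)$ satisfy the KKT system $\nabla_xL(\bar x,\bar u)=0$, $0\in\partial g^*(\bar u)-F(\bar x)$, where $L(x,u)=h(x)+\langle u,F(x)\rangle$. If the constraint nondegeneracy condition $$\nabla F(\bar x)\mathbb{R}^n+\operatorname{lin}\{d\in\mathbb{R}^m\mid dg(F(\bar x))(d)=\langle\bar u,d\rangle\}=\mathbb{R}^m$$ holds and in addition $g$ is $\mathcal{C}^2$-cone reducible, then the second-order qualification condition $$\ker(\nabla F(\bar x)^T)\cap D^*(\partial g)(F(\bar x),\bar u)(0)=\{0\}$$ is satisfied.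
   Context: $\overline{\mathbb{R}}=\mathbb{R}\cup\{\infty\}$; $\partial g$ is the subdifferential of convex analysis; $g^*$ is the Fenchel conjugate; $\operatorname{lin}C=C\cap(-C)$ for a closed convex cone $C$; $dg(y)(d):=\liminf_{\tau\downarrow0,d'\to d}\frac{g(y+\tau d')-g(y)}{\tau}$ for $y\in\operatorname{dom}g$. Coderivative. For $C\subset\mathbb{R}^p$, $\widehat{\mathcal N}_C(\bar z):=\{v\mid\langle v,z-\bar z\rangle\le o(\|z-\bar z\|),\ z\in C\}$ and $\mathcal N_C(\bar z):=\{v\mid\exists z^k\to\bar z,\ z^k\in C,\ v^k\in\widehat{\mathcal N}_C(z^k),\ v^k\to v\}$. For $S:\mathbb{R}^p\rightrightarrows\mathbb{R}^q$ and $\bar s\in S(\bar z)$, $D^*S(\bar z,\bar s)(y):=\{v\mid(v,-y)\in\mathcal N_{\operatorname{gph}S}(\bar z,\bar s)\}$. $\mathcal{C}^2$-cone reducibility. A closed convex set $C\subset\mathbb{R}^p$ is $\mathcal{C}^2$-cone reducible at $\bar z\in C$ if there are a closed convex set $K\subset\mathbb{R}^s$, a neighborhood $N$ of $\bar z$ and a $\mathcal{C}^2$-smooth $\Xi:N\to\mathbb{R}^s$ with $\nabla\Xi(\bar z)$ surjective, $C\cap N=\{z\in N\mid\Xi(z)\in K\}$, and $K-\Xi(\bar z)$ a pointed closed convex cone. A lower semicontinuous convex $f$ is $\mathcal{C}^2$-cone reducible if for every $y\in\operatorname{dom}f$ the set $\operatorname{epi}f$ is $\mathcal{C}^2$-cone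 reducible at $(y,f(y))$. *)

(* Defs.v *)
From mathcomp Require Export all_boot all_order all_algebra.
From mathcomp Require Export all_classical all_reals all_analysis.

Set Implicit Arguments.
Unset Strict Implicit.
Unset Printing Implicit Defensive.

Export Order.TTheory GRing.Theory Num.Theory.
Export numFieldNormedType.Exports.

Global Open Scope classical_set_scope.
Global Open Scope ring_scope.

(* Vectors are rows.  The library norm on 'rV[R]_p is the sup norm; since all
   norms on R^p are equivalent, limits, neighborhoods and o(||.||) do not depend
   on that choice.  The Jacobian matrix of the library acts on rows,
   'd F x v = v *m jacobian F x, so it is the transpose of the usual one. *)

Definition dot (R : realType) (p : nat) (u v : 'rV[R]_p) : R :=
  \sum_(i < p) u ord0 i * v ord0 i.

Definition gradient (R : realType) (n : nat) (f : 'rV[R]_n -> R) (x : 'rV[R]_n) :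
    'rV[R]_n :=
  \row_(i < n) 'D_(delta_mx ord0 i) f x.

(* In finite dimension, and for U open, this is the usual C^2-smoothness on U:
   f is twice differentiable on U and its second derivative is continuous. *)
Definition C2_on (R : realType) (n : nat) (W : normedModType R)
    (U : set 'rV[R]_n) (f : 'rV[R]_n -> W) : Prop :=
  forall x, U x ->
    [/\ differentiable f x,
        forall v, differentiable ('D_v f) x
      & forall v w, {for x, continuous ('D_w ('D_v f))}].

Definition effective_domain (R : realType) (p : nat) (f : 'rV[R]_p -> \bar R) :
    set 'rV[R]_p :=
  [set y | (f y < +oo)%E].

Definition epigraph (R : realType) (p : nat) (f : 'rV[R]_p -> \bar R) :
    set 'rV[R]_(p + 1) :=
  [set z | (f (lsubmx z) <= (rsubmx z ord0 ord0)%:E)%E].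

Definition proper (R : realType) (p : nat) (f : 'rV[R]_p -> \bar R) : Prop :=
  (forall y, -oo < f y)%E /\ effective_domain f !=set0.

(* The library has 0 * +oo = 0, so t = 0 and t = 1 are harmless. *)
Definition econvex (R : realType) (p : nat) (f : 'rV[R]_p -> \bar R) : Prop :=
  forall (x y : 'rV[R]_p) (t : R), 0 <= t <= 1 ->
    (f (t *: x + (1 - t) *: y)%R <= t%:E * f x + (1 - t)%:E * f y)%E.

Definition subdifferential (R : realType) (p : nat) (f : 'rV[R]_p -> \bar R)
    (x : 'rV[R]_p) : set 'rV[R]_p :=
  [set v | f x \is a fin_num /\
           forall z, (f x + (dot v (z - x))%:E <= f z)%E].

Definition fenchel_conjugate (R : realType) (p : nat) (f : 'rV[R]_p -> \bar R)
    (u : 'rV[R]_p) : \bar R :=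
  ereal_sup [set ((dot u y)%:E - f y)%E | y in [set: 'rV[R]_p]].

(* The subderivative df(y)(d), meant for y in dom f. *)
Definition subderivative (R : realType) (p : nat) (f : 'rV[R]_p -> \bar R)
    (y d : 'rV[R]_p) : \bar R :=
  limf_einf
    (fun q : R * 'rV[R]_p => ((f (y + q.1 *: q.2)%R - f y) * (q.1^-1)%:E)%E)
    (filter_prod (at_right (0 : R)) (nbhs d)).

Definition lin (R : realType) (p : nat) (C : set 'rV[R]_p) : set 'rV[R]_p :=
  C `&` [set - x | x in C].

(* For zbar in C. *)
Definition regular_normal_cone (R : realType) (p : nat) (C : set 'rV[R]_p)
    (zbar : 'rV[R]_p) : set 'rV[R]_p :=
  [set v | forall e : R, 0 < e ->
     \forall z \near nbhs zbar, C z -> dot v (z - zbar) <= e * `|z - zbar|].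

Definition limiting_normal_cone (R : realType) (p : nat) (C : set 'rV[R]_p)
    (zbar : 'rV[R]_p) : set 'rV[R]_p :=
  [set v | exists z_ v_ : nat -> 'rV[R]_p,
     [/\ z_ @ \oo --> zbar,
         forall k, C (z_ k),
         forall k, regular_normal_cone C (z_ k) (v_ k)
       & v_ @ \oo --> v]].

Definition graph_of (R : realType) (p q : nat)
    (S : 'rV[R]_p -> set 'rV[R]_q) : set 'rV[R]_(p + q) :=
  [set w | S (lsubmx w) (rsubmx w)].

(* For sbar in S zbar. *)
Definition coderivative (R : realType) (p q : nat)
    (S : 'rV[R]_p -> set 'rV[R]_q) (zbar : 'rV[R]_p) (sbar : 'rV[R]_q)
    (y : 'rV[R]_q) : set 'rV[R]_p :=
  [set v | limiting_normal_cone (graph_of S) (row_mx zbar sbar) (row_mx v (- y))].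

Definition pointed_closed_convex_cone (R : realType) (s : nat)
    (D : set 'rV[R]_s) : Prop :=
  [/\ closed D,
      @convex_set R 'rV[R]_s D,
      forall (t : R) x, 0 <= t -> D x -> D (t *: x)
    & lin D = [set 0]].

(* Any neighborhood N may be shrunk to its interior, so N is taken open.  Xi is
   a total function, of which only the restriction to N matters. *)
Definition C2_cone_reducible_at (R : realType) (p : nat) (C : set 'rV[R]_p)
    (zbar : 'rV[R]_p) : Prop :=
  exists (s : nat) (K : set 'rV[R]_s) (N : set 'rV[R]_p)
         (Xi : 'rV[R]_p -> 'rV[R]_s),
    [/\ closed K /\ @convex_set R 'rV[R]_s K,
        open_nbhs zbar N,
        C2_on N Xi /\ range ('d Xi zbar) = [set: 'rV[R]_s],
        C `&` N = [set z | N z /\ K (Xi z)]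
      & pointed_closed_convex_cone [set k - Xi zbar | k in K]].

(* For f lower semicontinuous and convex. *)
Definition C2_cone_reducible (R : realType) (p : nat)
    (f : 'rV[R]_p -> \bar R) : Prop :=
  forall y, effective_domain f y ->
    C2_cone_reducible_at (epigraph f) (row_mx y (fine (f y))%:M).

Definition lagrangian (R : realType) (n m : nat) (h : 'rV[R]_n -> R)
    (F : 'rV[R]_n -> 'rV[R]_m) (x : 'rV[R]_n) (u : 'rV[R]_m) : R :=
  h x + dot u (F x).

Definition KKT (R : realType) (n m : nat) (h : 'rV[R]_n -> R)
    (F : 'rV[R]_n -> 'rV[R]_m) (g : 'rV[R]_m -> \bar R)
    (x : 'rV[R]_n) (u : 'rV[R]_m) : Prop :=
  gradient (fun z => lagrangian h F z u) x = 0 /\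
  [set w - F x | w in subdifferential (fenchel_conjugate g) u] 0.

Definition constraint_nondegenerate (R : realType) (n m : nat)
    (F : 'rV[R]_n -> 'rV[R]_m) (g : 'rV[R]_m -> \bar R)
    (x : 'rV[R]_n) (u : 'rV[R]_m) : Prop :=
  [set a + b | a in range ('d F x) &
               b in lin [set d | subderivative g (F x) d = (dot u d)%:E]]
  = [set: 'rV[R]_m].

Definition second_order_qualification (R : realType) (n m : nat)
    (F : 'rV[R]_n -> 'rV[R]_m) (g : 'rV[R]_m -> \bar R)
    (x : 'rV[R]_n) (u : 'rV[R]_m) : Prop :=
  [set y | y *m (jacobian F x)^T = 0] `&`
    coderivative (subdifferential g) (F x) u 0
  = [set 0].

(* Main.v *)
(* For d in lin{d | dg(ybar)(d) = <ubar,d>}, the vector w = (d, <ubar,d>) lies in the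
   lineality space of the tangent cone of epi g at (ybar, g(ybar)).  In a reduction
   epi g = Xi^-1(K), pointedness puts w in the kernel of the derivative of Xi at that
   point, so at distance delta from it one can move by t w within a fibre of Xi, up to
   an error O(t (delta + t)).  K and the value of Xi being unchanged, the multiplier
   lam of a normal vector (u,-1) = lam *m A^T to epi g, A the Jacobian of Xi, remains a
   multiplier; since A is Lipschitz, the normal vector moves by O(t).  Hence the graph
   of the subdifferential contains, near each of its points (y,u), the points
   (y + t d, u) + (O(t (delta + t)), O(t)); testing a regular normal (a,b) on them
   gives <a,d> <= O(delta) |a| + O(1) |b|, and for a limiting normal (v,0) this is
   <v,d> <= 0.  So v is orthogonal to all such d, and also to the range of the
   derivative of F; by nondegeneracy v = 0. *)

From HB Require Import structures.
Require Import Defs.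
From mathcomp Require Import ring lra.

Set Implicit Arguments.
Unset Strict Implicit.
Unset Printing Implicit Defensive.

(** * Dot product, sup norm and mean value inequality *)

Lemma dotE (R : realType) p (u v : 'rV[R]_p) : dot u v = (u *m v^T) ord0 ord0.
Proof. by rewrite mxE; apply: eq_bigr => i _; rewrite mxE. Qed.

Lemma dotC (R : realType) p (u v : 'rV[R]_p) : dot u v = dot v u.
Proof. by apply: eq_bigr => i _; rewrite mulrC. Qed.

Lemma dotDr (R : realType) p (u v w : 'rV[R]_p) : dot u (v + w) = dot u v + dot u w.
Proof. by rewrite !dotE linearD/= mulmxDr mxE. Qed.

Lemma dot0r (R : realType) p (u : 'rV[R]_p) : dot u 0 = 0.
Proof. by rewrite dotE trmx0 mulmx0 mxE. Qed.

Lemma dotZr (R : realType) p (u v : 'rV[R]_p) k : dot u (k *: v) = k * dot u v.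
Proof. by rewrite !dotE linearZ/= -scalemxAr mxE. Qed.

Lemma dotNr (R : realType) p (u v : 'rV[R]_p) : dot u (- v) = - dot u v.
Proof. by rewrite -scaleN1r dotZr mulN1r. Qed.

Lemma dotBr (R : realType) p (u v w : 'rV[R]_p) : dot u (v - w) = dot u v - dot u w.
Proof. by rewrite dotDr dotNr. Qed.

Lemma dotDl (R : realType) p (u v w : 'rV[R]_p) : dot (v + w) u = dot v u + dot w u.
Proof. by rewrite dotC dotDr !(dotC u). Qed.

Lemma dotZl (R : realType) p (u v : 'rV[R]_p) k : dot (k *: v) u = k * dot v u.
Proof. by rewrite dotC dotZr (dotC u). Qed.

Lemma dotNl (R : realType) p (u v : 'rV[R]_p) : dot (- v) u = - dot v u.
Proof. by rewrite dotC dotNr (dotC u). Qed.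

Lemma dotBl (R : realType) p (u v w : 'rV[R]_p) : dot (v - w) u = dot v u - dot w u.
Proof. by rewrite dotDl dotNl. Qed.

Lemma dot_mulmx (R : realType) p q (u : 'rV[R]_p) (v : 'rV[R]_q) (A : 'M[R]_(p, q)) :
  dot (u *m A) v = dot u (v *m A^T).
Proof. by rewrite !dotE trmx_mul trmxK mulmxA. Qed.

Lemma dot_row_mx (R : realType) p q (a c : 'rV[R]_p) (b d : 'rV[R]_q) :
  dot (row_mx a b) (row_mx c d) = dot a c + dot b d.
Proof. by rewrite !dotE tr_row_mx mul_row_col mxE. Qed.

Lemma dot_scalar_mx (R : realType) (a b : R) :
  dot (a%:M : 'rV[R]_1) (b%:M : 'rV[R]_1) = a * b.
Proof. by rewrite /dot big_ord1 !mxE eqxx !mulr1n. Qed.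

Lemma dot_ge0 (R : realType) p (u : 'rV[R]_p) : 0 <= dot u u.
Proof. by apply: sumr_ge0 => i _; rewrite -expr2 sqr_ge0. Qed.

Lemma dot_eq0 (R : realType) p (u : 'rV[R]_p) : dot u u = 0 -> u = 0.
Proof.
move=> /psumr_eq0P u0; apply/rowP => i; rewrite mxE; apply/eqP.
by rewrite -sqrf_eq0 expr2 u0// => j _; rewrite -expr2 sqr_ge0.
Qed.

Lemma mx_norm_leP (R : realType) p q (A : 'M[R]_(p, q)) (e : R) : 0 <= e ->
  reflect (forall i j, `|A i j| <= e) (`|A| <= e).
Proof.
move=> e0; rewrite /Num.norm/= mx_normrE; apply: (iffP idP).
  by move=> /bigmax_leP[_ H] i j; exact: (H (i, j)).
by move=> H; apply/bigmax_leP; split => // -[i j] _; exact: H.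
Qed.

Lemma norm_entry_le (R : realType) p q (A : 'M[R]_(p, q)) i j : `|A i j| <= `|A|.
Proof. by move: i j; apply/mx_norm_leP. Qed.

Lemma norm_mulmx_le (R : realType) p q r (A : 'M[R]_(p, q)) (B : 'M[R]_(q, r)) :
  `|A *m B| <= q%:R * `|A| * `|B|.
Proof.
apply/mx_norm_leP => [|i j]; first by rewrite !mulr_ge0.
rewrite mxE (le_trans (ler_norm_sum _ _ _))//.
rewrite -[X in X%:R](card_ord q) -sum1_card natr_sum !mulr_suml ler_sum// => k _.
by rewrite mul1r normrM ler_pM// norm_entry_le.
Qed.

Lemma norm_trmx (R : realType) p q (A : 'M[R]_(p, q)) : `|A^T| = `|A|.
Proof.
apply/eqP; rewrite eq_le; apply/andP; split; apply/mx_norm_leP => // i j.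
  by rewrite mxE norm_entry_le.
by have := norm_entry_le A^T j i; rewrite mxE.
Qed.

Lemma norm_dot_le (R : realType) p (u v : 'rV[R]_p) : `|dot u v| <= p%:R * `|u| * `|v|.
Proof.
rewrite dotE (le_trans (norm_entry_le _ _ _))// (le_trans (norm_mulmx_le _ _))//.
by rewrite norm_trmx.
Qed.

Lemma norm_row_mx_le (R : realType) p q r (A : 'M[R]_(r, p)) (B : 'M[R]_(r, q)) e :
  (`|row_mx A B| <= e) = (`|A| <= e) && (`|B| <= e).
Proof.
have [e0|e0] := leP 0 e; last first.
  by rewrite !leNgt !(lt_le_trans e0).
apply/idP/andP => [/(mx_norm_leP _ e0) H|[/(mx_norm_leP _ e0) H1 /(mx_norm_leP _ e0) H2]].
  split; apply/mx_norm_leP => // i j.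
    by have := H i (lshift _ j); rewrite row_mxEl.
  by have := H i (rshift _ j); rewrite row_mxEr.
apply/mx_norm_leP => // i j; rewrite mxE.
by case: (fintype.split j) => k; [exact: H1|exact: H2].
Qed.

Lemma norm_scalar_mx1 (R : realType) (a : R) : `|(a%:M : 'M[R]_1)| = `|a|.
Proof.
apply/eqP; rewrite eq_le; apply/andP; split.
  by apply/mx_norm_leP => // i j; rewrite mxE !ord1 eqxx mulr1n.
by have := norm_entry_le (a%:M : 'M[R]_1) ord0 ord0; rewrite mxE eqxx mulr1n.
Qed.

(** The scalar mean value theorem is applied to each coordinate of [f] along the segment; as the
    norm is the sup norm, no dimensional factor appears. *)
Lemma mean_value_ineq (R : realType) p s (f : 'rV[R]_p -> 'rV[R]_s)
    (a b : 'rV[R]_p) (M : R) :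
  (forall t : R, 0 <= t <= 1 -> differentiable f (a + t *: (b - a))) ->
  (forall t : R, 0 <= t <= 1 -> `|'D_(b - a) f (a + t *: (b - a))| <= M) ->
  `|f b - f a| <= M.
Proof.
move=> df bf; set v := b - a in df bf *.
have M0 : 0 <= M by apply: le_trans (bf 0 _) => //; rewrite lexx ler01.
apply/mx_norm_leP => // i j.
pose phi (t : R) : R := f (a + t *: v) i j.
have dphi (t : R) : 0 <= t <= 1 -> is_derive t 1 phi ('D_v f (a + t *: v) i j).
  move=> /df dfa; have dv : derivable f (a + t *: v) v by exact: diff_derivable.
  pose c (t : R) := f (a + t *: v).
  have qE : (fun h : R => h^-1 *: (c (h *: 1 + t) - c t)) =
      (fun h : R => h^-1 *: (f (h *: v + (a + t *: v)) - f (a + t *: v))).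
    by apply/funext => h; rewrite /c [h *: 1]mulr1 scalerDl addrCA.
  have dc : derivable c t 1 by rewrite /derivable qE.
  have <- : 'D_1 c t = 'D_v f (a + t *: v) by rewrite /derive qE.
  rewrite derive_mx// mxE; apply: derivableP.
  by have /derivable_mxP := dc; exact.
have cphi : {within `[0, 1], continuous phi}.
  by apply: derivable_within_continuous => t t01; have [] := dphi t t01.
have [t t01] := @MVT_segment R phi (fun t => 'D_v f (a + t *: v) i j) 0 1 ler01
   (fun t t01 => dphi t (subset_itv_oo_cc t01)) cphi.
rewrite subr0 mulr1 /phi scale1r scale0r addr0 addrCA subrr addr0 !mxE => ->.
by rewrite (le_trans (norm_entry_le _ _ _))// bf.
Qed.

(** * First-order models of C2 maps *)

Lemma segment_norm_le (R : realType) (V : normedModType R) (c a b : V) (e t : R) :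
  `|a - c| <= e -> `|b - c| <= e -> 0 <= t <= 1 -> `|a + t *: (b - a) - c| <= e.
Proof.
move=> ae be /andP[t0 t1].
have -> : a + t *: (b - a) - c = (1 - t) *: (a - c) + t *: (b - c).
  have -> : b - a = (b - c) - (a - c) by rewrite opprB subrKA.
  rewrite addrAC [t *: (_ - (a - c))]scalerBr scalerBl scale1r.
  by rewrite [RHS]addrAC addrA.
rewrite (le_trans (ler_normD _ _))// !normrZ (ger0_norm t0) ger0_norm ?subr_ge0//.
have -> : e = (1 - t) * e + t * e by ring.
by rewrite lerD// ler_wpM2l// subr_ge0.
Qed.

Lemma ler_term_sum (R : realType) p (F : 'I_p -> R) k :
  (forall i, 0 <= F i) -> F k <= \sum_(i < p) F i.
Proof. by move=> F0; rewrite (bigD1 k)//= lerDl sumr_ge0. Qed.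

(* The derivative in the last clause is taken at a third point c: c = z gives a
   quadratic remainder, c = z0 the contraction estimate of local_solution. *)
Definition first_order_model (R : realType) p s (Xi : 'rV[R]_p -> 'rV[R]_s)
    (A : 'rV[R]_p -> 'M[R]_(p, s)) (z0 : 'rV[R]_p) (r L : R) : Prop :=
  [/\ 0 < r, 0 <= L,
      forall z z', `|z - z0| <= r -> `|z' - z0| <= r ->
        `|A z - A z'| <= L * `|z - z'|
    & forall c z z' d, `|c - z0| <= r -> `|z - z0| <= r -> `|z' - z0| <= r ->
        `|z - c| <= d -> `|z' - c| <= d ->
        `|Xi z' - Xi z - (z' - z) *m A c| <= L * d * `|z' - z| ].

Lemma derive_sub_linear (R : realType) (V W : normedModType R) (f : V -> W)
    (l : {linear V -> W}) x v : continuous l -> differentiable f x ->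
  differentiable (f - (l : V -> W)) x /\ 'D_v (f - (l : V -> W)) x = 'D_v f x - l v.
Proof.
move=> cl df; have dl : differentiable l x by exact: linear_differentiable.
have dfl := differentiableB df dl.
by split => //; rewrite !deriveE// diffB// diff_lin.
Qed.

Lemma row_jacobian (R : realType) p s (f : 'rV[R]_p -> 'rV[R]_s) z (i : 'I_p) :
  differentiable f z -> row i (jacobian f z) = 'D_(delta_mx ord0 i) f z.
Proof. by move=> df; rewrite deriveEjacobian// rowE. Qed.

Lemma norm_derive_le (R : realType) p s (f : 'rV[R]_p -> 'rV[R]_s) z v (M : R) :
  0 <= M -> differentiable f z ->
  (forall i : 'I_p, `|'D_(delta_mx ord0 i) f z| <= M) ->
  `|'D_v f z| <= p%:R * `|v| * M.
Proof.
move=> M0 df dM; rewrite deriveEjacobian// (le_trans (norm_mulmx_le _ _))//.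
rewrite ler_wpM2l// ?mulr_ge0//.
apply/mx_norm_leP => // i j; have := dM i; rewrite -row_jacobian//.
by apply: le_trans; have := norm_entry_le (row i (jacobian f z)) ord0 j; rewrite mxE.
Qed.

(** A bound on the second partial derivatives near [z0] makes the Jacobian Lipschitz, by the mean
    value inequality for each first partial derivative. The expansion is the same inequality for
    [Xi] minus its derivative at [c], a map whose derivative is O([d]) within distance [d] of
    [c]. *)
Lemma C2_on_first_order_model (R : realType) p s (N : set 'rV[R]_p)
    (Xi : 'rV[R]_p -> 'rV[R]_s) z0 :
  open_nbhs z0 N -> C2_on N Xi ->
  exists r L, first_order_model Xi (fun z => jacobian Xi z) z0 r L /\
    (forall z, `|z - z0| <= r -> N z).
Proof.
move=> [oN Nz0] C2.
pose D (i k : 'I_p) (z : 'rV[R]_p) : 'rV[R]_s :=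
  'D_(delta_mx ord0 k) ('D_(delta_mx ord0 i) Xi) z.
(* Adding 1 to each term leaves room for continuity: near [z0] every second partial derivative stays
   below its own summand, hence below the sum. *)
pose M := \sum_(k < p) \sum_(i < p) (`|D i k z0| + 1).
have M0 : 0 <= M by do 2 (apply: sumr_ge0 => ? _); rewrite addr_ge0.
have DM : \forall z \near z0, forall ik : 'I_p * 'I_p, `|D ik.1 ik.2 z| <= M.
  apply: (@filter_forall _ _ _ _ (nbhs_filter z0)) => -[i k] /=.
  have [_ _ /(_ (delta_mx ord0 i) (delta_mx ord0 k)) cD] := C2 _ Nz0.
  have c1 : D i k z @[z --> z0] --> D i k z0 by exact: cD.
  have D1 : `|D i k z0| < `|D i k z0| + 1 by rewrite ltrDl.
  have H := @cvgr_norm_lt R _ _ _ (nbhs_filter z0) _ _ c1 _ D1.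
  have MD : `|D i k z0| + 1 <= M.
    pose row_sum k := \sum_(i < p) (`|D i k z0| + 1).
    apply: le_trans (ler_term_sum (F := row_sum) k _) => [|k']; last first.
      by apply: sumr_ge0 => ? _; rewrite addr_ge0.
    by apply: (ler_term_sum (F := fun i => `|D i k z0| + 1) i) => i'; rewrite addr_ge0.
  by apply: filterS H => z /ltW/le_trans; apply.
have [r r0 rP] : exists2 r : R, 0 < r &
    forall z, `|z - z0| <= r -> N z /\ forall ik : 'I_p * 'I_p, `|D ik.1 ik.2 z| <= M.
  have : \forall z \near z0, N z /\ forall ik : 'I_p * 'I_p, `|D ik.1 ik.2 z| <= M.
    by apply: filterI => //; exact: open_nbhs_nbhs.
  move=> /nbhs_normP[e /= e0 eP]; exists (e / 2); first by rewrite divr_gt0.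
  move=> z ze; apply: eP => /=; rewrite distrC (le_lt_trans ze)//.
  by rewrite ltr_pdivrMr// ltr_pMr// ltr1n.
have Jlip z z' : `|z - z0| <= r -> `|z' - z0| <= r ->
    `|jacobian Xi z - jacobian Xi z'| <= p%:R * M * `|z - z'|.
  move=> zr z'r; apply/mx_norm_leP => [|i j]; first by rewrite !mulr_ge0.
  have seg (t : R) : 0 <= t <= 1 -> `|z' + t *: (z - z') - z0| <= r.
    exact: segment_norm_le.
  have := @mean_value_ineq R p s ('D_(delta_mx ord0 i) Xi) z' z (p%:R * `|z - z'| * M).
  have HD t : 0 <= t <= 1 ->
      differentiable ('D_(delta_mx ord0 i) Xi) (z' + t *: (z - z')).
    by move=> /seg/rP[/C2[]].
  move=> /(_ HD) H.
  have {}H : `|'D_(delta_mx ord0 i) Xi z - 'D_(delta_mx ord0 i) Xi z'|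
     <= p%:R * `|z - z'| * M.
    apply: H => t t01; apply: norm_derive_le => //; first exact: HD.
    by move=> k; have [_ /(_ (i, k))] := rP _ (seg _ t01).
  rewrite mulrAC (le_trans _ H)//.
  have [[/C2[dz _ _] _] [/C2[dz' _ _] _]] := (rP _ zr, rP _ z'r).
  rewrite -!row_jacobian//.
  have := norm_entry_le (row i (jacobian Xi z) - row i (jacobian Xi z')) ord0 j.
  by rewrite !mxE.
(* The first summand is the Lipschitz constant of the Jacobian; the second carries one more factor
   [p%:R], from passing to directional derivatives. *)
exists r, (p%:R * M + p%:R * (p%:R * M)); split; last by move=> z /rP[].
split => //.
- by rewrite addr_ge0// !mulr_ge0.
- move=> z z' zr z'r; rewrite (le_trans (Jlip _ _ zr z'r))// ler_wpM2r//.
  by rewrite lerDl !mulr_ge0.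
move=> c z z' d cr zr z'r zd z'd.
have d0 : 0 <= d by apply: le_trans zd.
have seg (t : R) : 0 <= t <= 1 -> `|z + t *: (z' - z) - z0| <= r.
  exact: segment_norm_le.
have segd (t : R) : 0 <= t <= 1 -> `|z + t *: (z' - z) - c| <= d.
  exact: segment_norm_le.
have [/C2[dXc _ _] _] := rP _ cr.
pose f : 'rV[R]_p -> 'rV[R]_s := Xi - ('d Xi c : 'rV[R]_p -> 'rV[R]_s).
have dE v : 'd Xi c v = v *m jacobian Xi c by rewrite -deriveEjacobian// deriveE.
have cl : continuous ('d Xi c) by exact: diff_continuous.
have df (t : R) v : 0 <= t <= 1 -> differentiable f (z + t *: (z' - z)) /\
    'D_v f (z + t *: (z' - z)) = 'D_v Xi (z + t *: (z' - z)) - 'd Xi c v.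
  by move=> /seg/rP[/C2[dX _ _] _]; exact: derive_sub_linear.
have H := @mean_value_ineq R p s f z z' (p%:R * `|z' - z| * (p%:R * M * d))
  (fun t t01 => (df t 0 t01).1).
have fE : f z' - f z = Xi z' - Xi z - (z' - z) *m jacobian Xi c.
  have dB : 'd Xi c (z' - z) = 'd Xi c z' - 'd Xi c z by exact: linearB.
  rewrite -dE dB /f !fctE; set a := 'd Xi c z'; set b := 'd Xi c z.
  by rewrite !opprB [LHS]addrACA [RHS]addrACA [- a - Xi z]addrC.
rewrite -fE; apply: le_trans (H _) _ => [t t01|]; last first.
  rewrite [leLHS](_ : _ = p%:R * (p%:R * M) * d * `|z' - z|); last by ring.
  by rewrite ler_wpM2r// ler_wpM2r// lerDr mulr_ge0.
have [/C2[dX _ _] _] := rP _ (seg _ t01).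
rewrite (df t _ t01).2 dE deriveEjacobian// -mulmxBr.
rewrite (le_trans (norm_mulmx_le _ _))// ler_wpM2l// ?mulr_ge0//.
rewrite (le_trans (Jlip _ _ (seg _ t01) cr))// ler_wpM2l// ?mulr_ge0//; exact: segd.
Unshelve. all: by end_near. Qed.

(** * Local solvability and multiplier bounds *)

(** For [|x| <= 2 * e], both [|T x - T 0|] and [|T 0|] are at most [e], so the closed ball of radius
    [2 * e] is stable and Banach's fixed point theorem applies on it. *)
Lemma half_contraction_fixpoint (R : realType) (V : completeNormedModType R)
    (T : V -> V) (e : R) :
  `|T 0| <= e ->
  (forall x y, `|x| <= 2 * e -> `|y| <= 2 * e -> `|T x - T y| <= 2^-1 * `|x - y|) ->
  exists2 x, `|x| <= 2 * e & T x = x.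
Proof.
move=> T0 Tc; have e0 : 0 <= e by apply: le_trans T0.
pose U := [set x : V | `|x| <= 2 * e].
have T_U : {homo T : x / U x >-> U x}.
  move=> x /= Ux; have := Tc x 0 Ux; rewrite normr0 subr0 => /(_ _)/wrap[|H].
    by rewrite mulr_ge0.
  have -> : T x = (T x - T 0) + T 0 by rewrite subrK.
  rewrite /U/= in Ux *; have := ler_normD (T x - T 0) (T 0); lra.
pose g : {fun U >-> U} := HB.pack T (isFun.Build _ _ U U T T_U).
have half0 : (0 : R) <= 2^-1 by [].
have gc : is_contraction g.
  exists (NngNum half0); split => /=; first by lra.
  by move=> [x y] [/= Ux Uy]; exact: Tc.
have U0 : U !=set0 by exists 0; rewrite /U/= normr0 mulr_ge0.
have cU : closed U.
  have -> : U = (fun x : V => `|x|) @^-1` [set x : R | x <= 2 * e] by [].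
  by apply: preimage_closed (@closed_le _ _) => x _; exact: norm_continuous.
by have [x Ux xE] := banach_fixed_point gc cU U0; exists x.
Qed.

(** Metric regularity of [Xi], with one constant for all [z] near [z0]. The derivative at [z0] sends
    [x *m P] back to [x], so corrections of the form [x *m P] suffice. *)
Lemma local_solution (R : realType) p s (Xi : 'rV[R]_p -> 'rV[R]_s) A z0 r L
    (P : 'M[R]_(s, p)) :
  first_order_model Xi A z0 r L -> P *m A z0 = 1%:M ->
  exists r1 c : R, [/\ 0 < r1, 0 <= c &
    forall z eta, `|z - z0| <= r1 -> `|eta - Xi z| <= r1 ->
      exists2 z', Xi z' = eta & `|z' - z| <= c * `|eta - Xi z|].
Proof.
move=> [r0 L0 _ expand] PA.
pose k := s%:R * `|P| + 1.
have k1 : 1 <= k by rewrite lerDr mulr_ge0.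
have k0 : 0 < k by lra.
have normP (x : 'rV[R]_s) : `|x *m P| <= k * `|x|.
  rewrite (le_trans (norm_mulmx_le _ _))// /k mulrDl mul1r mulrAC lerDl//.
(* Within distance [d] of [z0] the map [T] below has Lipschitz constant [L * d * k], at most 1/2. *)
pose d := Num.min r (2 * (L + 1) * k)^-1.
have D0 : 0 < 2 * (L + 1) * k by rewrite !mulr_gt0//; lra.
have d0 : 0 < d by rewrite lt_min r0 invr_gt0.
have dr : d <= r by rewrite ge_min lexx.
have Ldk : L * d * k <= 2^-1.
  have dD : d <= (2 * (L + 1) * k)^-1 by rewrite ge_min lexx orbT.
  have : d * (2 * (L + 1) * k) <= 1 by rewrite -ler_pdivlMr// div1r.
  have : 0 <= d * k by rewrite mulr_ge0 ?ltW.
  by nra.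
have K0 : 0 < 1 + 2 * k by lra.
(* The radius splits [d]: [z] is within [d / (1 + 2 * k)] of [z0], and [|x *m P| <= k * (2 * e)]
   takes at most the rest. *)
exists (d / (1 + 2 * k)), (2 * k); split => [||z eta zr etar].
- by rewrite divr_gt0.
- by lra.
set e := `|eta - Xi z| in etar *.
(* A fixed point x of T solves Xi (z + x *m P) = eta. *)
pose T (x : 'rV[R]_s) := x - (Xi (z + x *m P) - eta).
have zP (x : 'rV[R]_s) : `|x| <= 2 * e -> `|z + x *m P - z0| <= d.
  move=> xe; rewrite addrAC (le_trans (ler_normD _ _))//.
  have -> : d = d / (1 + 2 * k) + k * (2 * (d / (1 + 2 * k))).
    by field; rewrite gt_eqF.
  rewrite lerD// (le_trans (normP _))// ler_wpM2l ?(ltW k0)//.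
  by rewrite (le_trans xe)// ler_wpM2l.
have T0 : `|T 0| <= e by rewrite /T mul0mx addr0 sub0r opprB.
have Tc x y : `|x| <= 2 * e -> `|y| <= 2 * e -> `|T x - T y| <= 2^-1 * `|x - y|.
  move=> xe ye; have [xd yd] := (zP x xe, zP y ye).
  have := expand z0 (z + y *m P) (z + x *m P) d.
  rewrite subrr normr0 (ltW r0) !(le_trans _ dr)// => /(_ isT isT isT yd xd).
  have -> : z + x *m P - (z + y *m P) = (x - y) *m P.
    by rewrite mulmxBl opprD addrACA subrr add0r.
  rewrite -mulmxA PA mulmx1 => H.
  have -> : T x - T y = x - y - (Xi (z + x *m P) - Xi (z + y *m P)).
    by apply/rowP => i; rewrite /T !mxE; ring.
  rewrite [leLHS]distrC (le_trans H)// (@le_trans _ _ (L * d * (k * `|x - y|)))//.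
    by rewrite ler_wpM2l// mulr_ge0// ltW.
  by rewrite mulrA ler_wpM2r.
pose V : completeNormedModType R := HB.pack 'rV[R]_s.
have [x xe Tx] := @half_contraction_fixpoint R V T e T0 Tc.
exists (z + x *m P).
  apply/eqP; rewrite -subr_eq0.
  have -> : Xi (z + x *m P) - eta = x - T x by rewrite /T subKr.
  by rewrite Tx subrr.
by rewrite addrC addKr (le_trans (normP _))// [2 * k]mulrC -mulrA ler_wpM2l// (ltW k0).
Qed.

(** The dual counterpart of [local_solution]: the transposed derivative is bounded below at [z0],
    and near [z0] its perturbation costs at most half of [|lam|]. *)
Lemma multiplier_bound (R : realType) p s (Xi : 'rV[R]_p -> 'rV[R]_s) A z0 r L
    (P : 'M[R]_(s, p)) :
  first_order_model Xi A z0 r L -> P *m A z0 = 1%:M ->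
  exists r1 c : R, [/\ 0 < r1, 0 <= c &
    forall z (lam : 'rV[R]_s), `|z - z0| <= r1 -> `|lam| <= c * `|lam *m (A z)^T|].
Proof.
move=> [r0 L0 lip _] PA.
pose k := s%:R * (p%:R * `|P| * L).
have k0 : 0 <= k by rewrite !mulr_ge0.
exists (Num.min r (2 * (k + 1))^-1), (2 * (p%:R * `|P|)); split => [||z lam].
- by rewrite lt_min r0 invr_gt0 mulr_gt0//; lra.
- by rewrite !mulr_ge0.
rewrite le_min => /andP[zr zk].
have kz : k * `|z - z0| <= 2^-1.
  have : `|z - z0| * (2 * (k + 1)) <= 1 by rewrite -ler_pdivlMr ?div1r//; lra.
  by have : 0 <= `|z - z0| by []; nra.
(* Expands lam = lam *m (P *m A z0)^T around z, so P *m A z need not be inverted. *)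
have lamE : lam = lam *m (A z)^T *m P^T - lam *m (P *m (A z - A z0))^T.
  rewrite -mulmxA -trmx_mul -mulmxBr -linearB/= -mulmxBr subKr PA.
  by rewrite trmx1 mulmx1.
have h1 : `|lam *m (A z)^T *m P^T| <= p%:R * `|P| * `|lam *m (A z)^T|.
  by rewrite (le_trans (norm_mulmx_le _ _))// norm_trmx mulrAC.
have h2 : `|lam *m (P *m (A z - A z0))^T| <= 2^-1 * `|lam|.
  rewrite (le_trans (norm_mulmx_le _ _))// norm_trmx mulrAC ler_wpM2r//.
  rewrite (le_trans _ kz)// /k -[leRHS]mulrA ler_wpM2l// -[leRHS]mulrA.
  rewrite (le_trans (norm_mulmx_le _ _))// ler_wpM2l// ?mulr_ge0//.
  by rewrite lip// subrr normr0 ltW.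
have : `|lam| <= `|lam *m (A z)^T *m P^T| + `|lam *m (P *m (A z - A z0))^T|.
  by rewrite {1}lamE; exact: ler_normB.
lra.
Qed.

(** * Reduction charts: tangents, normals and multipliers *)

(** This is how second-order errors are dropped: a bound [t * a <= M * t ^+ 2] is divided by [t],
    and [t] tends to 0. *)
Lemma le0_of_small (R : realType) (a M e : R) : 0 < e ->
  (forall t, 0 < t -> t < e -> a <= M * t) -> a <= 0.
Proof.
move=> e0 H; rewrite leNgt; apply/negP => a0.
pose b := Num.min (e / 2) (a / (2 * (`|M| + 1))).
have M1 : 0 < 2 * (`|M| + 1) by rewrite mulr_gt0// ltr_wpDl.
have b0 : 0 < b by rewrite lt_min !divr_gt0.
have be : b < e by rewrite gt_min ltr_pdivrMr// ltr_pMr// ltr1n.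
have ba : b * (2 * (`|M| + 1)) <= a by rewrite -ler_pdivlMr// ge_min lexx orbT.
have := H b b0 be; have := ler_norm M; have := normr_ge0 M; nra.
Qed.

Lemma closed_approx (R : realType) (V : normedModType R) (D : set V) y :
  closed D -> (forall e : R, 0 < e -> exists2 x, D x & `|y - x| < e) -> D y.
Proof.
move=> cD H; apply: cD => B /nbhs_normP[e /= e0 eB].
by have [x Dx xy] := H e e0; exists x; split => //; exact: eB.
Qed.

Definition segment_closed (R : realType) p (C : set 'rV[R]_p) : Prop :=
  forall x y (t : R), 0 <= t <= 1 -> C x -> C y -> C (x + t *: (y - x)).

Lemma convex_set_segment (R : realType) p (K : set 'rV[R]_p) :
  @convex_set R 'rV[R]_p K -> segment_closed K.
Proof.
move=> cK x y t /andP[t0 t1] Kx Ky.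
have := cK y x (Itv01 t0 t1) (mem_set Ky) (mem_set Kx); rewrite inE.
rewrite [conv _ _ _](_ : _ = x + t *: (y - x))//.
rewrite /conv/= /unstable.onem; apply/rowP => i; rewrite !mxE; ring.
Qed.

(** At a point of a convex set [C], this is the normal cone of convex analysis. *)
Definition convex_normal (R : realType) p (C : set 'rV[R]_p) (z v : 'rV[R]_p) : Prop :=
  forall z', C z' -> dot v (z' - z) <= 0.

(** The Bouligand tangent cone, with a single [e] controlling both the step and the error in the
    direction, in place of sequences. *)
Definition tangent (R : realType) p (C : set 'rV[R]_p) (z w : 'rV[R]_p) : Prop :=
  forall e : R, 0 < e ->
    exists t w', [/\ 0 < t, t < e, `|w' - w| < e & C (z + t *: w')].

Lemma first_order_model_le (R : realType) p s (Xi : 'rV[R]_p -> 'rV[R]_s) A z0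
    (r r' L : R) : 0 < r' -> r' <= r ->
  first_order_model Xi A z0 r L -> first_order_model Xi A z0 r' L.
Proof.
move=> r'0 r'r [r0 L0 lip expand]; split => //.
  by move=> z z' /le_trans/(_ r'r) ? /le_trans/(_ r'r); exact: lip.
move=> c z z' d /le_trans/(_ r'r) ? /le_trans/(_ r'r) ? /le_trans/(_ r'r).
  exact: expand.
Qed.

Lemma quadratic_remainder (R : realType) p s (Xi : 'rV[R]_p -> 'rV[R]_s) A z0
    (r L : R) z xi : first_order_model Xi A z0 r L ->
  `|z - z0| <= r -> `|z + xi - z0| <= r ->
  `|Xi (z + xi) - Xi z - xi *m A z| <= L * `|xi| ^+ 2.
Proof.
move=> [r0 L0 _ expand] zr zxr.
have := expand z z (z + xi) `|xi| zr zr zxr.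
by rewrite subrr normr0 (addrC z) addrK -mulrA => /(_ (normr_ge0 _) (lexx _)).
Qed.

(** The radius [r] and the constant [c] do not depend on [z]; this uniformity is what allows
    estimates at points moving towards [z0]. [chart_solve] is metric regularity of [Xi], and
    [chart_multiplier] is its dual. *)
Record reduction_chart (R : realType) p s (C : set 'rV[R]_p) (K : set 'rV[R]_s)
    (Xi : 'rV[R]_p -> 'rV[R]_s) (A : 'rV[R]_p -> 'M[R]_(p, s)) (z0 : 'rV[R]_p)
    (r L c : R) : Prop := ReductionChart {
  chart_model : first_order_model Xi A z0 r L ;
  chart_set : forall z, `|z - z0| <= r -> C z <-> K (Xi z) ;
  chart_c_ge0 : 0 <= c ;
  chart_solve : forall z eta, `|z - z0| <= r -> `|eta - Xi z| <= r ->
    exists2 z', Xi z' = eta & `|z' - z| <= c * `|eta - Xi z| ;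
  chart_multiplier : forall z (lam : 'rV[R]_s), `|z - z0| <= r ->
    `|lam| <= c * `|lam *m (A z)^T| }.

Lemma small_step (R : realType) p (z z0 xi : 'rV[R]_p) (r : R) : `|z - z0| < r ->
  exists2 e : R, 0 < e & forall t, 0 < t -> t < e -> `|z + t *: xi - z0| < r.
Proof.
move=> zr; have X1 : 0 < `|xi| + 1 by rewrite ltr_wpDl.
exists ((r - `|z - z0|) / (`|xi| + 1)); first by rewrite divr_gt0// subr_gt0.
move=> t t0; rewrite ltr_pdivlMr// => tr.
rewrite addrAC (le_lt_trans (ler_normD _ _))// normrZ gtr0_norm//.
have := normr_ge0 xi; nra.
Qed.

(** Since K - Xi z0 is a cone, it contains the difference quotients of [Xi] along the tangent steps;
    they approach [w *m A z0], and the cone is closed. *)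
Lemma tangent_derivative (R : realType) p s (C : set 'rV[R]_p) (K : set 'rV[R]_s)
    Xi A z0 (r L c : R) w : reduction_chart C K Xi A z0 r L c -> K (Xi z0) ->
  pointed_closed_convex_cone [set k - Xi z0 | k in K] ->
  tangent C z0 w -> [set k - Xi z0 | k in K] (w *m A z0).
Proof.
move=> ch K0 [cD _ coneD _] tw; apply: closed_approx cD _ => e e0.
have [r0 L0 _ _] := chart_model ch.
pose B := `|w| + 1; have B1 : 1 <= B by rewrite lerDr.
(* Up to the factor [e'], the first term bounds the quadratic remainder and the second the effect of
   replacing [w'] by [w]. *)
pose M := L * B ^+ 2 + p%:R * `|A z0| + 1.
have M1 : 1 <= M by rewrite lerDr addr_ge0// mulr_ge0// exprn_ge0//; lra.
pose e' := Num.min 1 (Num.min (r / B) (e / (M + 1))).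
have e'0 : 0 < e' by rewrite !lt_min ltr01 !divr_gt0//; lra.
have [e'1 e'r e'e] : [/\ e' <= 1, e' * B <= r & e' * (M + 1) <= e].
  rewrite -!ler_pdivlMr; [|lra..].
  by rewrite /e' !ge_min !lexx !orbT.
have [t [w' [t0 te w'e Cw']]] := tw e' e'0.
have w'B : `|w'| <= B.
  rewrite -[w'](subrK w) (le_trans (ler_normD _ _))// addrC lerD2l; lra.
have tw'r : `|t *: w'| <= r.
  by rewrite normrZ gtr0_norm// (le_trans _ e'r)// ler_pM// ltW.
have zr : `|z0 + t *: w' - z0| <= r by rewrite addrC addKr.
have Kw : K (Xi (z0 + t *: w')) by apply/(chart_set ch).
have := quadratic_remainder (chart_model ch) _ zr.
rewrite subrr normr0 => /(_ (ltW r0)) rem.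
exists (t^-1 *: (Xi (z0 + t *: w') - Xi z0)).
  by apply: coneD; [rewrite invr_ge0 ltW|exists (Xi (z0 + t *: w'))].
set x := Xi _ - Xi z0 in rem *.
have -> : w *m A z0 - t^-1 *: x =
    - (t^-1 *: (x - (t *: w') *m A z0)) - (w' - w) *m A z0.
  rewrite mulmxBl -scalemxAl; move: x (w *m _) (w' *m _) {rem} => x a b.
  by apply/rowP => j; rewrite !mxE; field; rewrite gt_eqF.
rewrite (le_lt_trans (ler_normB _ _))// normrN normrZ gtr0_norm ?invr_gt0//.
have h1 : t^-1 * `|x - (t *: w') *m A z0| <= L * B ^+ 2 * e'.
  rewrite mulrC ler_pdivrMr// (le_trans rem)// normrZ gtr0_norm// exprMn.
  have : `|w'| ^+ 2 <= B ^+ 2 by rewrite lerXn2r// nnegrE//; lra.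
  have : 0 <= `|w'| ^+ 2 by rewrite exprn_ge0.
  move: (`|w'| ^+ 2) (B ^+ 2) => a b a0 ab.
  have -> : L * b * e' * t = L * (b * (e' * t)) by ring.
  rewrite ler_wpM2l// mulrC expr2 ler_pM// ?mulr_ge0 ?ler_wpM2r ?ltW//.
have h2 : `|(w' - w) *m A z0| <= p%:R * `|A z0| * e'.
  by rewrite (le_trans (norm_mulmx_le _ _))// mulrAC ler_wpM2l ?mulr_ge0// ltW.
have : L * B ^+ 2 * e' + p%:R * `|A z0| * e' < e' * (M + 1).
  rewrite /M -mulrDl mulrC ltr_pM2l//; lra.
lra.
Qed.

(** The normal [v] is nonpositive on every [xi] whose linearised image [Xi z + xi *m A z] lies in
    [K]. Hence it vanishes on the kernel of [A z] and factors through [A z]; lifting [k - Xi z]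
    through the pseudo-inverse shows that the factor is normal to [K]. *)
Lemma chart_normal_multiplier (R : realType) p s (C : set 'rV[R]_p) (K : set 'rV[R]_s)
    Xi A z0 (r L c : R) z v : reduction_chart C K Xi A z0 r L c ->
  segment_closed K -> C z -> `|z - z0| < r -> convex_normal C z v ->
  exists lam, [/\ v = lam *m (A z)^T, `|lam| <= c * `|v| &
                  convex_normal K (Xi z) lam].
Proof.
move=> ch cK Cz zr nv.
have [r0 L0 _ _] := chart_model ch; have c0 := chart_c_ge0 ch.
have Kz : K (Xi z) by apply/(chart_set ch) => //; exact: ltW.
(* From z + t xi one returns to Xi^-1(K) by a correction of order t^2. *)
have polar xi : K (Xi z + xi *m A z) -> dot v xi <= 0.
  move=> Kxi.
  have [e e0 eP] := small_step xi zr.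
  pose Q := L * `|xi| ^+ 2.
  have Q0 : 0 <= Q by rewrite mulr_ge0// exprn_ge0.
  (* For [t < q] the defect is within the reach of [chart_solve], and both [z + t *: xi] and the
     corrected point stay in the ball of the chart. *)
  pose q := Num.min r (r - `|z - z0|) / (`|xi| + c * Q + Q + 1).
  have D1 : 0 < `|xi| + c * Q + Q + 1 by rewrite ltr_wpDl// !addr_ge0// mulr_ge0.
  have q0 : 0 < q by rewrite divr_gt0// lt_min r0 subr_gt0.
  apply: (@le0_of_small _ _ (p%:R * `|v| * (c * Q)) (Num.min 1 q)).
    by rewrite lt_min ltr01.
  move=> t t0; rewrite lt_min => /andP[t1 tq].
  have : t * (`|xi| + c * Q + Q + 1) < Num.min r (r - `|z - z0|).
    by rewrite -ltr_pdivlMr.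
  rewrite lt_min => /andP[tr1 tr2].
  have t2 : t ^+ 2 <= t by rewrite expr2 ger_pMl// ltW.
  have zt : `|z + t *: xi - z0| <= `|z - z0| + t * `|xi|.
    by rewrite addrAC (le_trans (ler_normD _ _))// normrZ gtr0_norm.
  have cQ0 : 0 <= c * Q by rewrite mulr_ge0.
  have ztr : `|z + t *: xi - z0| <= r.
    rewrite (le_trans zt)//; have := normr_ge0 xi; nra.
  have := quadratic_remainder (chart_model ch) (ltW zr) ztr.
  rewrite normrZ gtr0_norm// exprMn [L * _]mulrCA -/Q => rem.
  pose eta := Xi z + (t *: xi) *m A z.
  have etaE : `|eta - Xi (z + t *: xi)| <= t ^+ 2 * Q.
    by rewrite distrC /eta opprD addrA.
  have Keta : K eta.
    have := cK _ _ t _ Kz Kxi; rewrite addrAC subrr add0r scalemxAl; apply.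
    by rewrite !ltW.
  have [|z' z'eta z'd] := chart_solve ch (eta := eta) ztr.
    by rewrite (le_trans etaE)//; have := normr_ge0 xi; nra.
  have {}z'd : `|z' - (z + t *: xi)| <= c * Q * t ^+ 2.
    by rewrite (le_trans z'd)// -mulrA ler_wpM2l// mulrC.
  have Cz' : C z'.
    apply/(chart_set ch); last by rewrite z'eta.
    have -> : z' - z0 = z' - (z + t *: xi) + (z + t *: xi - z0) by rewrite subrKA.
    rewrite (le_trans (ler_normD _ _))//.
    have := normr_ge0 xi; nra.
  have := nv _ Cz'.
  have -> : z' - z = z' - (z + t *: xi) + t *: xi by rewrite opprD addrA subrK.
  rewrite dotDr dotZr => H.
  have := norm_dot_le v (z' - (z + t *: xi)).
  rewrite ler_norml => /andP[+ _].
  have : p%:R * `|v| * `|z' - (z + t *: xi)| <= p%:R * `|v| * (c * Q * t ^+ 2).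
    by rewrite ler_wpM2l// mulr_ge0.
  move: (dot v (z' - _)) H => a H h1 h2.
  rewrite -(ler_pM2l t0); move: h1 h2 H; rewrite expr2; lra.
have full : row_full (A z).
  rewrite /row_full -mxrank_tr; apply: inj_row_free => lam lamA.
  apply/eqP; rewrite -normr_le0.
  by have := chart_multiplier ch lam (ltW zr); rewrite lamA normr0 mulr0.
have : (v <= (A z)^T)%MS.
  (* Each column of the cokernel of the transpose is a vector [xi] in the kernel of [A z]; applying
     [polar] to [xi] and [- xi] gives [dot v xi = 0]. *)
  rewrite submxE; apply/eqP/rowP => j; rewrite [RHS]mxE.
  pose xi := row j (cokermx (A z)^T)^T.
  have xiA : xi *m A z = 0.
    by rewrite -row_mul -[X in row j X]trmxK trmx_mul trmxK mulmx_coker trmx0 row0.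
  have -> : (v *m cokermx (A z)^T) ord0 j = dot v xi.
    by rewrite mxE; apply: eq_bigr => i _; rewrite !mxE.
  apply/eqP; rewrite eq_le polar ?xiA ?addr0//= -oppr_le0 -dotNr.
  by apply: polar; rewrite mulNmx xiA oppr0 addr0.
move=> /submxP[lam vE]; exists lam; split => //.
  by rewrite vE; apply: (chart_multiplier ch) => //; exact: ltW.
move=> k Kk; have := polar ((k - Xi z) *m pinvmx (A z)).
rewrite -mulmxA mulVpmx// mulmx1 addrC subrK => /(_ Kk).
by rewrite vE dot_mulmx trmxK -mulmxA mulVpmx// mulmx1.
Qed.

(** By convexity of [C] the segment from [z] to [z'] is mapped into [K]. Testing [lam] on its
    initial part and expanding [Xi] to first order gives the inequality in the limit. *)
Lemma chart_normal_of_multiplier (R : realType) p s (C : set 'rV[R]_p)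
    (K : set 'rV[R]_s) Xi A z0 (r L c : R) z lam :
  reduction_chart C K Xi A z0 r L c ->
  segment_closed C -> C z -> `|z - z0| < r -> convex_normal K (Xi z) lam ->
  convex_normal C z (lam *m (A z)^T).
Proof.
move=> ch cC Cz zr nlam z' Cz'; rewrite dot_mulmx trmxK.
set xi := z' - z.
have [e e0 eP] := small_step xi zr.
have [r0 L0 _ _] := chart_model ch.
apply: (@le0_of_small _ _ (s%:R * `|lam| * (L * `|xi| ^+ 2)) (Num.min 1 e)).
  by rewrite lt_min ltr01.
move=> t t0; rewrite lt_min => /andP[t1 te].
have ztr := ltW (eP t t0 te).
have Kt : K (Xi (z + t *: xi)).
  by apply/(chart_set ch) => //; apply: cC => //; rewrite !ltW.
have := quadratic_remainder (chart_model ch) (ltW zr) ztr.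
rewrite normrZ gtr0_norm// exprMn => rem.
have := nlam _ Kt.
set x := Xi _ - Xi z in rem *.
have -> : x = (x - (t *: xi) *m A z) + t *: (xi *m A z).
  by rewrite -scalemxAl subrK.
rewrite dotDr dotZr => H.
have := norm_dot_le lam (x - (t *: xi) *m A z).
rewrite ler_norml => /andP[+ _].
have : s%:R * `|lam| * `|x - (t *: xi) *m A z| <=
       s%:R * `|lam| * (L * (t ^+ 2 * `|xi| ^+ 2)).
  by rewrite ler_wpM2l// mulr_ge0.
move: (dot lam (x - _)) H => a H h1 h2.
rewrite -(ler_pM2l t0); move: h1 h2 H; rewrite !expr2; lra.
Qed.

(** * Transport of normals along the lineality space *)

Lemma chart_transport (R : realType) p s (C : set 'rV[R]_p) (K : set 'rV[R]_s)
    Xi A z0 (r L c : R) w :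
  reduction_chart C K Xi A z0 r L c -> segment_closed C -> segment_closed K ->
  w *m A z0 = 0 ->
  exists q M : R, [/\ 0 < q, 0 <= M &
    forall z v (t : R), C z -> `|z - z0| <= q -> 0 < t -> t <= q -> convex_normal C z v ->
    exists z' v', [/\ C z', convex_normal C z' v',
      `|z' - z - t *: w| <= M * t * (`|z - z0| + t) & `|v' - v| <= M * t * `|v|] ].
Proof.
move=> ch cC cK wA.
have [r0 L0 lip expand] := chart_model ch; have c0 := chart_c_ge0 ch.
have W0 := normr_ge0 w.
pose Q := L * (1 + `|w|) * `|w|.
have Q0 : 0 <= Q by rewrite !mulr_ge0// addr_ge0.
have cQ0 : 0 <= c * Q by rewrite mulr_ge0.
(* The terms account for [z - z0], the step [t *: w], the defect in [Xi] and its correction, so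
   [q * B < r] keeps the whole construction inside the chart. *)
pose B := 1 + `|w| + 2 * Q + 2 * (c * Q).
have B0 : 0 < B by rewrite /B; lra.
pose M2 := s%:R * (c * L) * (`|w| + 2 * (c * Q)).
have M20 : 0 <= M2 by rewrite !mulr_ge0// addr_ge0// mulr_ge0.
pose q := Num.min 1 (r / (2 * B)).
have q0 : 0 < q by rewrite lt_min ltr01 divr_gt0// mulr_gt0.
have q1 : q <= 1 by rewrite ge_min lexx.
have qB : q * B < r.
  have : q * (2 * B) <= r.
    by rewrite -ler_pdivlMr ?mulr_gt0// ge_min lexx orbT.
  lra.
exists q, (c * Q + M2); split => //; first by rewrite addr_ge0.
move=> z v t Cz zq t0 tq nv.
set d := `|z - z0| in zq *.
have d0 : 0 <= d by exact: normr_ge0.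
have [qW qQ qcQ] : [/\ 0 <= q * `|w|, 0 <= q * Q & 0 <= q * (c * Q)].
  by rewrite !mulr_ge0// ltW.
have qBE : q * B = q + q * `|w| + 2 * (q * Q) + 2 * (q * (c * Q)) by rewrite /B; ring.
have zr : d < r by lra.
have tW : t * `|w| <= q * `|w| by rewrite ler_wpM2r.
have ztd : `|z + t *: w - z0| <= d + t * `|w|.
  by rewrite addrAC (le_trans (ler_normD _ _))// normrZ gtr0_norm.
have ztr : `|z + t *: w - z0| <= r by lra.
have dtW0 : 0 <= t * `|w| by rewrite mulr_ge0// ltW.
(* The expansion is centred at [z0], where the derivative annihilates [w]; this yields the factor
   [d + t] in the defect. *)
have := expand z0 (z + t *: w) z (d + t * `|w|).
rewrite subrr normr0 -/d => /(_ (ltW r0) ztr (ltW zr) ztd).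
rewrite lerDl => /(_ dtW0).
have -> : z - (z + t *: w) = - (t *: w) by rewrite opprD addrA subrr add0r.
rewrite mulNmx -scalemxAl wA scaler0 oppr0 subr0 normrN normrZ gtr0_norm// => XiE.
have {}XiE : `|Xi z - Xi (z + t *: w)| <= t * Q * (d + t).
  rewrite (le_trans XiE)// /Q.
  have -> : t * (L * (1 + `|w|) * `|w|) * (d + t) =
     L * ((1 + `|w|) * (d + t)) * (t * `|w|) by ring.
  by rewrite ler_wpM2r// ler_wpM2l//; nra.
have tQ : t * Q * (d + t) <= 2 * (q * Q).
  have : t * Q <= q * Q by rewrite ler_wpM2r.
  have : 0 <= t * Q by rewrite mulr_ge0// ltW.
  nra.
have [|z' z'Xi z'd] := chart_solve ch (eta := Xi z) ztr; first by lra.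
have {}z'd : `|z' - (z + t *: w)| <= c * Q * t * (d + t).
  rewrite (le_trans z'd)// -[c * Q * t]mulrA -mulrA ler_wpM2l//.
  by rewrite [Q * t]mulrC.
have ctq : c * Q * t * (d + t) <= 2 * (q * (c * Q)).
  have : c * Q * t <= q * (c * Q) by rewrite mulrC ler_wpM2r.
  have : 0 <= c * Q * t by rewrite mulr_ge0// ltW.
  nra.
have ctt : c * Q * t * (d + t) <= 2 * (c * Q) * t.
  have : 0 <= c * Q * t by rewrite mulr_ge0// ltW.
  nra.
have z'r : `|z' - z0| < r.
  have -> : z' - z0 = z' - (z + t *: w) + (z + t *: w - z0) by rewrite subrKA.
  rewrite (le_lt_trans (ler_normD _ _))//; lra.
have Kz : K (Xi z) by apply/(chart_set ch) => //; exact: ltW.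
have Cz' : C z' by apply/(chart_set ch); [exact: ltW|rewrite z'Xi].
(* As [Xi z' = Xi z], this multiplier is also normal to [K] at [Xi z']; only the matrix [A] changes
   between the two normals. *)
have [lam [vE lamv nlam]] := chart_normal_multiplier ch cK Cz zr nv.
exists z', (lam *m (A z')^T); split => //.
- by apply: (chart_normal_of_multiplier ch) => //; rewrite z'Xi.
- rewrite -addrA -opprD (le_trans z'd)//.
  rewrite ler_wpM2r ?addr_ge0 ?(ltW t0)//.
  by rewrite ler_wpM2r ?(ltW t0)// lerDl.
rewrite vE -mulmxBr -linearB/= (le_trans (norm_mulmx_le _ _))// norm_trmx -vE.
have zz' : `|z' - z| <= t * (`|w| + 2 * (c * Q)).
  have -> : z' - z = z' - (z + t *: w) + t *: w by rewrite opprD addrA subrK.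
  rewrite (le_trans (ler_normD _ _))// normrZ gtr0_norm//; lra.
have lipz : `|A z' - A z| <= L * (t * (`|w| + 2 * (c * Q))).
  by rewrite (le_trans (lip _ _ (ltW z'r) (ltW zr)))// ler_wpM2l.
apply: (@le_trans _ _ (s%:R * (c * `|v|) * (L * (t * (`|w| + 2 * (c * Q)))))).
  by rewrite ler_pM// ?mulr_ge0// ler_wpM2l.
have -> : s%:R * (c * `|v|) * (L * (t * (`|w| + 2 * (c * Q)))) = M2 * t * `|v|.
  by rewrite /M2; ring.
by rewrite ler_wpM2r// ler_wpM2r ?(ltW t0)// lerDr.
Qed.

(** Surjectivity of the derivative makes the pseudo-inverse of [A z0] a one-sided inverse, which
    feeds both [local_solution] and [multiplier_bound]. *)
Lemma C2_cone_reducible_chart (R : realType) p (C : set 'rV[R]_p) z0 :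
  C2_cone_reducible_at C z0 -> C z0 ->
  exists s (K : set 'rV[R]_s) Xi A r L c,
    [/\ reduction_chart C K Xi A z0 r L c, K (Xi z0), segment_closed K
      & pointed_closed_convex_cone [set k - Xi z0 | k in K] ].
Proof.
move=> [s [K [N [Xi [[_ cK] oN [C2 surj] CN pK]]]]] Cz0.
have Nz0 : N z0 by case: oN.
have [r [L [model rN]]] := C2_on_first_order_model oN C2.
pose A z := jacobian Xi z.
have dXi v : 'd Xi z0 v = v *m A z0.
  by have [dXi _ _] := C2 _ Nz0; rewrite -deriveEjacobian// deriveE.
have full : row_full (A z0).
  rewrite -sub1mx; apply/row_subP => i.
  have : [set: 'rV[R]_s] (row i 1%:M) by [].
  by rewrite -surj => -[v _ <-]; rewrite dXi submxMl.
have PA := mulVpmx full.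
have [r1 [c1 [r10 c10 solve]]] := local_solution model PA.
have [r2 [c2 [r20 c20 mult]]] := multiplier_bound model PA.
have r0 : 0 < r by case: model.
pose q := Num.min r (Num.min r1 r2).
have q0 : 0 < q by rewrite !lt_min r0 r10.
have [qr qr1 qr2] : [/\ q <= r, q <= r1 & q <= r2].
  by rewrite !ge_min !lexx !orbT.
have CK z : N z -> C z <-> K (Xi z).
  move=> Nz; have : (C `&` N) z <-> [set z | N z /\ K (Xi z)] z by rewrite CN.
  by move=> /= [h1 h2]; split => [Cz|Kz]; [case: h1|case: h2].
exists s, K, Xi, A, q, L, (c1 + c2); split => //; last exact: convex_set_segment.
  split.
  - exact: first_order_model_le model.
  - by move=> z zq; apply: CK; apply: rN; exact: le_trans qr.
  - by rewrite addr_ge0.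
  - move=> z eta zq etaq.
    have [z' z'E z'd] := solve z eta (le_trans zq qr1) (le_trans etaq qr1).
    by exists z' => //; rewrite (le_trans z'd)// ler_wpM2r// lerDl.
  - move=> z lam zq; rewrite (le_trans (mult z lam (le_trans zq qr2)))//.
    by rewrite ler_wpM2r// lerDr.
by apply/CK.
Qed.

Lemma reducible_normal_transport (R : realType) p (C : set 'rV[R]_p) z0 w :
  segment_closed C -> C z0 -> C2_cone_reducible_at C z0 ->
  tangent C z0 w -> tangent C z0 (- w) ->
  exists q M : R, [/\ 0 < q, 0 <= M &
    forall z v (t : R), C z -> `|z - z0| <= q -> 0 < t -> t <= q -> convex_normal C z v ->
    exists z' v', [/\ C z', convex_normal C z' v',
      `|z' - z - t *: w| <= M * t * (`|z - z0| + t) & `|v' - v| <= M * t * `|v|] ].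
Proof.
move=> cC Cz0 /C2_cone_reducible_chart/(_ Cz0)[s [K [Xi [A [r [L [c]]]]]]].
move=> [ch K0 cK pK] tw tNw; apply: (chart_transport ch) => //.
have [_ _ _ lin0] := pK.
have : lin [set k - Xi z0 | k in K] (w *m A z0).
  split; first exact: (tangent_derivative ch).
  exists ((- w) *m A z0); first exact: (tangent_derivative ch).
  by rewrite mulNmx opprK.
by rewrite lin0.
Qed.

(** * Epigraphs and the conjugate subdifferential *)

Lemma continuous_dot_self (R : realType) p (x : 'rV[R]_p) :
  continuous (fun z : 'rV[R]_p => dot (z - x) (z - x)).
Proof.
have -> : (fun z => dot (z - x) (z - x)) =
    (fun z => \sum_(i < p) (z ord0 i - x ord0 i) * (z ord0 i - x ord0 i)).
  by apply/funext => z; apply: eq_bigr => i _; rewrite !mxE.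
apply: continuous_big => [|i _ z]; first exact: add_continuous.
have c0 : ((z' : 'rV[R]_p) ord0 i : R) @[z' --> z] --> (z ord0 i : R).
  exact: coord_continuous.
have c : (z' : 'rV[R]_p) ord0 i - x ord0 i @[z' --> z] --> z ord0 i - x ord0 i.
  exact: (@cvgB _ _ _ _ (nbhs_filter z) _ _ _ _ c0 (@cvg_cst _ _ _ _ (nbhs_filter z))).
exact: (@cvgM _ _ _ (nbhs_filter z) _ _ _ _ c c).
Qed.

Lemma sqr_norm_le_dot (R : realType) p (x : 'rV[R]_p) : `|x| ^+ 2 <= dot x x.
Proof.
have d0 := dot_ge0 x.
rewrite -(sqr_sqrtr d0) ler_sqr ?nnegrE ?sqrtr_ge0//.
apply/mx_norm_leP => [|i j]; first exact: sqrtr_ge0.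
rewrite -sqrtr_sqr ler_wsqrtr// ord1 expr2.
by apply: (ler_term_sum (F := fun j => x ord0 j * x ord0 j)) => k; rewrite -expr2 sqr_ge0.
Qed.

(** The point [z] is nearest for the Euclidean distance, not for the sup norm: minimality along
    segments then gives the variational inequality. Compactness comes from restricting to a sublevel
    set. *)
Lemma closed_projection (R : realType) p (C : set 'rV[R]_p) x :
  closed C -> segment_closed C -> C !=set0 ->
  exists2 z, C z & convex_normal C z (x - z).
Proof.
move=> cC sC [z0 Cz0].
pose f z := dot (z - x) (z - x).
have cf : continuous f by exact: continuous_dot_self.
pose B := C `&` (f @^-1` [set t | t <= f z0]).
have cB : closed B.
  by apply: closedI => //; apply: preimage_closed (@closed_le _ _) => ? _; exact: cf.
have bB : bounded_set B.
  exists (f z0 + 1 + `|x|); split; first by rewrite num_real.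
  move=> M MB z [_ /= fz]; rewrite (le_trans _ (ltW MB))//.
  rewrite -[z](subrK x) (le_trans (ler_normD _ _))// lerD2r.
  have := sqr_norm_le_dot (z - x); rewrite -/(f z) => h.
  have := normr_ge0 (z - x); nra.
have B0 : B !=set0 by exists z0; split => //=.
have [z + zmin] := EVT_min_rV B0 (bounded_closed_compact bB cB)
  (continuous_subspaceT cf).
rewrite inE => -[Cz fz]; exists z => // z' Cz'.
apply: (@le0_of_small _ _ (dot (z' - z) (z' - z) / 2) 1) => // t t0 t1.
have Czt : C (z + t *: (z' - z)) by apply: sC => //; rewrite !ltW.
have : f z <= f (z + t *: (z' - z)).
  have [le0|/ltW lt0] := leP (f (z + t *: (z' - z))) (f z0).
    by apply: zmin; rewrite inE.
  exact: le_trans lt0.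
rewrite /f [_ + _ - x]addrAC -[x - z]opprB; move: (z' - z) (z - x) => u e.
rewrite dotDl !dotDr !dotZl !dotZr dotNl [dot u e]dotC => H.
rewrite -(ler_pM2l t0); lra.
Qed.

Lemma lee_fin_cases (R : realType) (x : \bar R) (r : R) :
  (-oo < x)%E -> (x <= r%:E)%E -> exists2 t, x = t%:E & t <= r.
Proof. by case: x => // t _; rewrite lee_fin; exists t. Qed.

Lemma epigraph_segment_closed (R : realType) p (g : 'rV[R]_p -> \bar R) :
  proper g -> econvex g -> segment_closed (epigraph g).
Proof.
move=> [gNy _] cg x y t /andP[t0 t1]; rewrite /epigraph/= => gx gy.
have [a ax ar] := lee_fin_cases (gNy _) gx.
have [b bx br] := lee_fin_cases (gNy _) gy.
have := cg (lsubmx y) (lsubmx x) t; rewrite t0 t1 => /(_ isT).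
rewrite ax bx -!EFinM -EFinD => H.
rewrite [lsubmx (x + _)](_ : _ = t *: lsubmx y + (1 - t) *: lsubmx x); last first.
  by apply/rowP => i; rewrite !mxE; ring.
rewrite (le_trans H)// lee_fin !mxE.
move: ar br; rewrite !mxE; nra.
Qed.

Lemma epigraph_closed (R : realType) p (g : 'rV[R]_p -> \bar R) :
  lower_semicontinuous g -> closed (epigraph g).
Proof.
move=> lg z clz; rewrite /epigraph/= leNgt; apply/negP.
set r := rsubmx z ord0 ord0 => rg.
have [s rs sg] : exists2 s, r < s & (s%:E < g (lsubmx z))%E.
  case: (g (lsubmx z)) rg => [t| |]//.
    by rewrite lte_fin => rt; exists ((r + t) / 2); rewrite ?lte_fin; lra.
  by move=> _; exists (r + 1); rewrite ?ltry//; lra.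
have [V /nbhs_normP[e /= e0 eV] Vg] := lg _ _ sg.
have m0 : 0 < Num.min e (s - r) by rewrite lt_min e0 subr_gt0.
have /clz[x []] := nbhsx_ballx z _ m0.
rewrite -ball_normE /epigraph/= => gx; rewrite lt_min => /andP[xe xs].
have : (s%:E < g (lsubmx x))%E.
  apply: Vg; apply: eV => /=; rewrite (le_lt_trans _ xe)//.
  have := lexx `|z - x|; rewrite -{1}[z - x]hsubmxK norm_row_mx_le => /andP[+ _].
  by rewrite linearB.
rewrite ltNge (le_trans gx)// lee_fin.
have := norm_entry_le (z - x) ord0 (rshift p ord0); rewrite !mxE => h.
move: rs xs h; rewrite /r !mxE => rs xs h.
have := ler_norm (x ord0 (rshift p ord0) - z ord0 (rshift p ord0)); rewrite distrC; lra.
Qed.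

Lemma epigraphE (R : realType) p (g : 'rV[R]_p -> \bar R) y r :
  epigraph g (row_mx y r%:M) = (g y <= r%:E)%E.
Proof. by rewrite /epigraph/= row_mxKl row_mxKr mxE eqxx mulr1n. Qed.

(** It suffices that [g y <= b], the equality case of Fenchel-Young. Otherwise (y, b) lies below the
    closed convex epigraph, and projecting it yields an affine minorant of [g] whose slope [w]
    violates the subgradient inequality of the conjugate. *)
Lemma subdifferential_conjugate (R : realType) p (g : 'rV[R]_p -> \bar R) y u :
  proper g -> lower_semicontinuous g -> econvex g -> g y \is a fin_num ->
  subdifferential (fenchel_conjugate g) u y -> subdifferential g y u.
Proof.
move=> pg lg cg gy [afin asub]; have [gNy _] := pg.
have [a aE] : exists a, fenchel_conjugate g u = a%:E.
  by exists (fine (fenchel_conjugate g u)); rewrite fineK.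
have [c cE] : exists c, g y = c%:E by exists (fine (g y)); rewrite fineK.
have young w z : (((dot w z)%:E - g z)%E <= fenchel_conjugate g w)%E.
  by apply: ereal_sup_ubound; exists z.
pose b := dot u y - a.
have cb : c <= b.
  rewrite leNgt; apply/negP => bc.
  have ne : epigraph g !=set0 by exists (row_mx y c%:M); rewrite epigraphE cE.
  have [z Cz nz] := closed_projection (row_mx y b%:M) (epigraph_closed lg)
     (epigraph_segment_closed pg cg) ne.
  move: Cz nz; rewrite -[z]hsubmxK [rsubmx z]mx11_scalar.
  move: (lsubmx z) (rsubmx z 0 0) => q r; rewrite epigraphE => gq nz.
  have sep (z' : 'rV[R]_p) (t : R) :
      (g z' <= t%:E)%E -> dot (y - q) (z' - q) + (b - r) * (t - r) <= 0.
    rewrite -epigraphE => /nz.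
    by rewrite !opp_row_mx !add_row_mx dot_row_mx -!raddfB dot_scalar_mx.
  have br : b <= r.
    have := sep q (r + 1); rewrite (le_trans gq) ?lee_fin ?lerDl// => /(_ isT).
    by rewrite subrr dot0r add0r [r + 1 - r]addrAC subrr add0r mulr1 subr_le0.
  (* This excludes a vertical hyperplane: if [b = r], testing at the epigraph point (y, c) forces
     [q = y], hence [c <= b]. *)
  have {br} br : b < r.
    rewrite lt_neqAle br andbT; apply/eqP => bE.
    have := sep y c; rewrite cE lexx bE subrr mul0r addr0 => /(_ isT) yq0.
    have yq : y - q = 0.
      by apply: dot_eq0; apply/eqP; rewrite eq_le yq0 dot_ge0.
    move: gq; rewrite -[q](subrK y) -opprB yq oppr0 add0r cE lee_fin; lra.
  pose w := (r - b)^-1 *: (y - q).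
  have rb : 0 < r - b by rewrite subr_gt0.
  have minorant (z' : 'rV[R]_p) (t : R) : (g z' <= t%:E)%E -> dot w (z' - q) <= t - r.
    move=> /sep H; rewrite dotZl -(ler_pM2l rb) mulrA mulfV ?mul1r ?gt_eqF//; lra.
  have conj : (fenchel_conjugate g w <= (dot w q - r)%:E)%E.
    apply: ge_ereal_sup => _ [z' _ <-].
    have := gNy z'; case gz : (g z') => [t| |]// _.
      have := minorant z' t; rewrite gz lexx => /(_ isT).
      by rewrite dotBr -EFinB lee_fin; lra.
    by rewrite /= leNye.
  (* The subgradient inequality at [w] gives [dot w (y - q) <= b - r < 0], while [w] is a positive
     multiple of [y - q]. *)
  have := le_trans (asub w) conj; rewrite aE -EFinD lee_fin dotBr => H.
  have : 0 <= dot w (y - q).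
    by rewrite /w dotZl mulr_ge0 ?dot_ge0// invr_ge0 ltW.
  move: H; rewrite dotBr ![dot y _]dotC /b in br *; lra.
split => // z; have := gNy z; case gz : (g z) => [t| |]// _; last by rewrite leey.
have := young u z; rewrite gz aE cE -EFinB -EFinD !lee_fin dotBr /b in cb *; lra.
Qed.

(** * Subgradients and regular normals of their graph *)

Lemma subgradient_normal (R : realType) p (g : 'rV[R]_p -> \bar R) y u :
  proper g -> subdifferential g y u ->
  convex_normal (epigraph g) (row_mx y (fine (g y))%:M) (row_mx u (-1)%:M).
Proof.
move=> [gNy _] [gy sub] z; rewrite -[z]hsubmxK [rsubmx z]mx11_scalar epigraphE.
move: (lsubmx z) (rsubmx z 0 0) => x r.
rewrite opp_row_mx add_row_mx dot_row_mx -raddfB dot_scalar_mx => gx.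
have [t tE tr] := lee_fin_cases (gNy _) gx.
by have := sub x; rewrite tE -{1}[g y]fineK// -EFinD lee_fin; lra.
Qed.

Lemma row_mx_scalarP (R : realType) p (z : 'rV[R]_(p + 1)) :
  exists y r, z = row_mx y r%:M.
Proof. by exists (lsubmx z), (rsubmx z 0 0); rewrite -mx11_scalar hsubmxK. Qed.

Lemma normal_subgradient (R : realType) p (g : 'rV[R]_p -> \bar R) y w (r m : R) :
  proper g -> epigraph g (row_mx y r%:M) ->
  convex_normal (epigraph g) (row_mx y r%:M) (row_mx w m%:M) -> m < 0 ->
  subdifferential g y ((- m)^-1 *: w).
Proof.
move=> [gNy _]; rewrite epigraphE => gy nv m0.
have sep (x : 'rV[R]_p) (t : R) : (g x <= t%:E)%E -> dot w (x - y) + m * (t - r) <= 0.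
  rewrite -epigraphE => /nv.
  by rewrite opp_row_mx add_row_mx dot_row_mx -raddfB dot_scalar_mx.
have [c cE cr] := lee_fin_cases (gNy _) gy.
(* A negative last entry rules out points strictly above the graph: the point (y, c) can be
   tested. *)
have {}rE : r = c.
  apply/eqP; rewrite eq_le cr andbT.
  have := sep y c; rewrite cE lexx subrr dot0r add0r => /(_ isT).
  by rewrite nmulr_rle0// subr_ge0.
split => [|x]; first by rewrite cE.
have := gNy x; case gx : (g x) => [t| |]// _; last by rewrite leey.
have := sep x t; rewrite gx lexx cE -EFinD lee_fin dotZl -rE => /(_ isT) H.
have mN0 : 0 < - m by rewrite oppr_gt0.
rewrite -lerBrDl -(ler_pM2l mN0) mulrA mulfV ?mul1r ?gt_eqF//; lra.
Qed.

(* If g y = +oo, the conventions +oo - +oo = -oo and -oo * t = -oo for t > 0 make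
   every subderivative at y equal to -oo. *)
Lemma subderivative_fin_num (R : realType) p (g : 'rV[R]_p -> \bar R) y d (a : R) :
  proper g -> subderivative g y d = a%:E -> g y \is a fin_num.
Proof.
move=> [gNy _] sub; rewrite fin_numE gt_eqF//=; apply/eqP => gy.
have : ((a - 1)%:E < subderivative g y d)%E by rewrite sub lte_fin; lra.
rewrite /subderivative limf_einfE => /ereal_sup_gt[_ [V FV <-]].
have FV0 : filter_prod (at_right (0 : R)) (nbhs d) (V `&` [set q | 0 < q.1]).
  apply: filterI => //; exists ([set t | 0 < t], setT) => /=.
    by split; [exact: nbhs_right_gt|exact: filterT].
  by move=> q [].
have [q [Vq q0]] := filter_ex FV0.
rewrite ltNge; apply/negP/negPn; apply: (@le_trans _ _ -oo%E); last by rewrite leNye.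
apply: ereal_inf_lbound; exists q => //.
rewrite gy addeNy mulNyr/= gtr0_sg ?invr_gt0//.
by rewrite mul1e.
Qed.

(** Arbitrarily close to [d] and for arbitrarily small steps, some difference quotient is below
    [a + e / 2]; raising the last entry of the direction to that value lands in the epigraph. *)
Lemma subderivative_tangent (R : realType) p (g : 'rV[R]_p -> \bar R) y d (a : R) :
  proper g -> g y \is a fin_num -> subderivative g y d = a%:E ->
  tangent (epigraph g) (row_mx y (fine (g y))%:M) (row_mx d a%:M).
Proof.
move=> [gNy _] gy sub e e0.
pose V := [set q : R * 'rV[R]_p | 0 < q.1 < e /\ `|q.2 - d| < e].
have FV : filter_prod (at_right (0 : R)) (nbhs d) V.
  exists ([set t | 0 < t < e], ball d e) => /=.
    split; last exact: nbhsx_ballx.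
    near=> t; apply/andP; split; near: t; [exact: nbhs_right_gt|exact: nbhs_right_lt].
  move=> [t x] [/= te]; rewrite -ball_normE/= => xe.
  by split => //=; rewrite distrC.
have : (ereal_inf [set ((g (y + q.1 *: q.2)%R - g y) * (q.1^-1)%:E)%E | q in V] <
        (a + e / 2)%:E)%E.
  apply: (@le_lt_trans _ _ a%:E); last by rewrite lte_fin ltrDl divr_gt0.
  rewrite -sub /subderivative limf_einfE; apply: ereal_sup_ubound.
  by exists V.
move=> /ereal_inf_lt[_ [[t x] [/= /andP[t0 te] xe] <-]].
rewrite lte_pdivrMr// -EFinM => H.
exists t, (row_mx x (a + e / 2)%:M); split => //.
  rewrite opp_row_mx add_row_mx -raddfB.
  have -> : a + e / 2 - a = e / 2 by ring.
  have : `|row_mx (x - d) ((e / 2)%:M : 'rV_1)| <= Num.max `|x - d| (e / 2).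
    rewrite norm_row_mx_le norm_scalar_mx1 !le_max lexx/=.
    by rewrite ger0_norm ?divr_ge0 ?(ltW e0)// lexx orbT.
  by move=> /le_lt_trans; apply; rewrite gt_max xe/= ltr_pdivrMr// ltr_pMr// ltr1n.
rewrite scale_row_mx add_row_mx scale_scalar_mx -raddfD epigraphE.
have [c cE] : exists c, g y = c%:E by exists (fine (g y)); rewrite fineK.
rewrite cE/= in H *.
have := gNy (y + t *: x); case gx : (g (y + t *: x)) H => [b| |]//=.
by rewrite -EFinB lte_fin !lee_fin; lra.
Unshelve. all: by end_near. Qed.

(** The constants depend only on the reference data, not on the graph point (y, u), so the estimate
    can be used along a sequence of graph points. *)
Lemma regular_normal_bound (R : realType) m (g : 'rV[R]_m -> \bar R)
    (ybar ubar d : 'rV[R]_m) :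
  let Z y := row_mx y (fine (g y))%:M in
  proper g -> segment_closed (epigraph g) -> g ybar \is a fin_num ->
  C2_cone_reducible_at (epigraph g) (Z ybar) ->
  subderivative g ybar d = (dot ubar d)%:E ->
  subderivative g ybar (- d) = (dot ubar (- d))%:E ->
  exists q B : R, [/\ 0 < q, 0 <= B & forall y u a b,
    subdifferential g y u -> `|u| <= `|ubar| + 1 -> `|Z y - Z ybar| <= q ->
    regular_normal_cone (graph_of (subdifferential g)) (row_mx y u) (row_mx a b) ->
    dot a d <= B * (`|a| * `|Z y - Z ybar| + `|b|)].
Proof.
move=> Z pg cg gy red subd subNd.
have epiZ y u : subdifferential g y u -> epigraph g (Z y).
  by move=> [gfin _]; rewrite epigraphE fineK.
have epi0 : epigraph g (Z ybar) by rewrite epigraphE fineK.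
pose w := row_mx d (dot ubar d)%:M.
have tw : tangent (epigraph g) (Z ybar) w by exact: subderivative_tangent.
have tNw : tangent (epigraph g) (Z ybar) (- w).
  by rewrite opp_row_mx -raddfN -dotNr; exact: subderivative_tangent.
have [q [M [q0 M0 transport]]] := reducible_normal_transport cg epi0 red tw tNw.
pose V := `|ubar| + 2.
have V2 : 2 <= V by rewrite /V lerDr.
(* [C2 * t] will bound the change of the subgradient, and [C3 * t] that of the whole graph point. *)
pose C2 := 2 * (M * V * (1 + V)).
pose C3 := `|d| + M * (q + 1) + C2.
have MV0 : 0 <= M * V by rewrite mulr_ge0//; lra.
have C20 : 0 <= C2 by rewrite !mulr_ge0//; lra.
have C30 : 0 <= C3 by rewrite !addr_ge0// mulr_ge0//; lra.
have mR0 : 0 <= m%:R :> R by [].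
exists q, (m%:R * (C2 + M)); split => //; first by rewrite mulr_ge0// addr_ge0.
move=> y u a b su uV Zq reg.
have [del delE] : exists del : R, `|Z y - Z ybar| = del by eexists.
have [del0 delq] : 0 <= del /\ del <= q by rewrite -delE.
rewrite delE.
have nv := subgradient_normal pg su.
set v : 'rV[R]_(m + 1) := row_mx u _ in nv.
have vV : `|v| <= V.
  by rewrite norm_row_mx_le norm_scalar_mx1 normrN1 /V in V2 *; apply/andP; split; lra.
(* The subtracted terms are the errors that survive division by the step; what remains is
   proportional to the tolerance [e] and is left to [le0_of_small]. *)
suff : dot a d - (m%:R * `|b| * C2 + m%:R * `|a| * M * del) <= 0.
  have a0 := normr_ge0 a; have b0 := normr_ge0 b; rewrite subr_le0 => H.
  rewrite (le_trans H)//.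
  have h1 : 0 <= m%:R * C2 * (`|a| * del) by apply: mulr_ge0; apply: mulr_ge0.
  have h2 : 0 <= m%:R * M * `|b| by apply: mulr_ge0 => //; apply: mulr_ge0.
  lra.
apply: (@le0_of_small _ _ (C3 + m%:R * `|a| * M) 1) => // e e0 e1.
have /nbhs_normP[rho /= rho0 rhoP] := reg e e0.
(* t is so small that the last entry mu of the moved normal satisfies
   |mu + 1| <= 1/2, and that the moved point of the graph is in the rho-ball. *)
pose t := Num.min (Num.min e q) (Num.min (2 * (M * V + 1))^-1 (rho / (2 * (C3 + 1)))).
have D1 : 0 < 2 * (M * V + 1) by lra.
have D2 : 0 < 2 * (C3 + 1) by lra.
have t0 : 0 < t by rewrite !lt_min e0 q0 invr_gt0 D1 divr_gt0.
have [te tq tMV tr] : [/\ t <= e, t <= q, t * (2 * (M * V + 1)) <= 1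
    & t * (2 * (C3 + 1)) <= rho].
  rewrite -!ler_pdivlMr// div1r /t !ge_min !lexx !orbT//.
have [z' [v' [Cz' nv' dz dv]]] := transport _ _ t (epiZ _ _ su) Zq t0 tq nv.
rewrite delE in dz.
have {}dv : `|v' - v| <= M * V * t.
  by rewrite (le_trans dv)// mulrAC ler_wpM2r ?(ltW t0)// ler_wpM2l.
have [y' [r' z'E]] := row_mx_scalarP z'; have [p' [mu v'E]] := row_mx_scalarP v'.
subst z' v'.
move: dz dv; rewrite scale_row_mx !opp_row_mx !add_row_mx !norm_row_mx_le.
move=> /andP[dy _] /andP[du]; rewrite -raddfB norm_scalar_mx1 opprK => dmu.
have MVt : M * V * t <= 1 / 2 by nra.
have mu1 : mu + 1 <= M * V * t by rewrite (le_trans (ler_norm _)).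
have mu0 : mu < 0 by lra.
have := normal_subgradient pg Cz' nv' mu0; set u' := _ *: p' => su'.
have du' : `|u' - u| <= C2 * t.
  (* Rescaling the last entry to -1 costs the term with [1 + mu]; since [- mu >= 1/2], the inverse
     contributes the factor 2 of [C2]. *)
  have -> : u' - u = (- mu)^-1 *: ((p' - u) + (1 + mu) *: u).
    apply/rowP => i; rewrite !mxE; field; rewrite lt_eqF//.
  rewrite normrZ gtr0_norm ?invr_gt0 ?oppr_gt0// mulrC ler_pdivrMr ?oppr_gt0//.
  rewrite (le_trans (ler_normD _ _))// normrZ.
  have h1 : `|1 + mu| * `|u| <= M * V * t * V.
    by rewrite ler_pM//; [rewrite addrC|rewrite /V; lra].
  have h2 : C2 * t * 2^-1 <= C2 * t * (- mu).
    by rewrite ler_wpM2l ?mulr_ge0// ?(ltW t0)//; lra.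
  by rewrite (le_trans _ h2)// /C2; lra.
have dyt : `|y' - y| <= (`|d| + M * (q + 1)) * t.
  have -> : y' - y = (y' - y - t *: d) + t *: d by rewrite subrK.
  rewrite (le_trans (ler_normD _ _))// normrZ gtr0_norm//.
  apply: (le_trans (lerD dy (lexx _))).
  have : M * t * (del + t) <= M * t * (q + 1).
    by rewrite ler_wpM2l ?mulr_ge0 ?(ltW t0)//; lra.
  lra.
have dx : `|row_mx y' u' - row_mx y u| <= C3 * t.
  have d0 : 0 <= (`|d| + M * (q + 1)) * t.
    by rewrite mulr_ge0 ?(ltW t0)// addr_ge0// mulr_ge0//; lra.
  have c0 : 0 <= C2 * t by rewrite mulr_ge0// ltW.
  by rewrite opp_row_mx add_row_mx norm_row_mx_le /C3; apply/andP; split; lra.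
have gu' : graph_of (subdifferential g) (row_mx y' u').
  by rewrite /graph_of/= row_mxKl row_mxKr.
have hr : `|row_mx y u - row_mx y' u'| < rho.
  by rewrite distrC (le_lt_trans dx)//; nra.
have := rhoP _ hr gu'; have rowB : row_mx y' u' - row_mx y u = row_mx (y' - y) (u' - u).
  by rewrite opp_row_mx add_row_mx.
rewrite {1}rowB dot_row_mx => H.
have H1 : e * `|row_mx y' u' - row_mx y u| <= e * (C3 * t) by rewrite ler_wpM2l// ltW.
have H2 : - dot b (u' - u) <= m%:R * `|b| * (C2 * t).
  rewrite -dotNr (le_trans (ler_norm _))// (le_trans (norm_dot_le _ _))// normrN.
  by rewrite ler_wpM2l// mulr_ge0.
have H3 : - dot a (y' - y - t *: d) <= m%:R * `|a| * (M * t * (del + t)).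
  rewrite -dotNr (le_trans (ler_norm _))// (le_trans (norm_dot_le _ _))// normrN.
  by rewrite ler_wpM2l// mulr_ge0.
have H4 : t * dot a d = dot a (y' - y) - dot a (y' - y - t *: d).
  by rewrite -dotBr subKr dotZr.
have H5 : m%:R * `|a| * M * t * t <= m%:R * `|a| * M * t * e.
  by rewrite ler_wpM2l// !mulr_ge0// ltW.
rewrite -(ler_pM2l t0); lra.
Qed.

(** * The second-order qualification condition *)

(** Convergence in the graph of the subdifferential says nothing directly about the values of [g];
    the subgradient inequalities at both points bound their difference from both sides. *)
Lemma subgradient_value_lipschitz (R : realType) p (g : 'rV[R]_p -> \bar R)
    (y ybar u ubar : 'rV[R]_p) :
  subdifferential g ybar ubar -> subdifferential g y u -> `|u| <= `|ubar| + 1 ->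
  `|row_mx y (fine (g y))%:M - row_mx ybar (fine (g ybar))%:M : 'rV_(p + 1)| <=
  (1 + p%:R * (`|ubar| + 1)) * `|y - ybar|.
Proof.
move=> [gbar subbar] [gy sub] uV.
have := sub ybar; have := subbar y.
rewrite -(fineK gbar) -(fineK gy) -!EFinD !lee_fin /=.
move: (fine (g y)) (fine (g ybar)) => b c h1 h2.
have k0 : 0 <= p%:R * (`|ubar| + 1) * `|y - ybar| by rewrite !mulr_ge0// addr_ge0.
rewrite opp_row_mx add_row_mx norm_row_mx_le -raddfB norm_scalar_mx1.
rewrite mulrDl mul1r lerDl k0/=.
have d1 := norm_dot_le ubar (y - ybar); have d2 := norm_dot_le u (ybar - y).
rewrite [`|ybar - y|]distrC in d2.
have d3 : p%:R * `|u| * `|y - ybar| <= p%:R * (`|ubar| + 1) * `|y - ybar|.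
  by rewrite ler_wpM2r// ler_wpM2l.
have d4 : p%:R * `|ubar| * `|y - ybar| <= p%:R * (`|ubar| + 1) * `|y - ybar|.
  by rewrite ler_wpM2r// ler_wpM2l// lerDl.
have n0 := normr_ge0 (y - ybar).
move: d1 d2; rewrite !ler_norml => /andP[d1 _] /andP[d2 _].
by apply/andP; split; lra.
Qed.

Lemma coderivative_subdifferential_polar (R : realType) m (g : 'rV[R]_m -> \bar R)
    (ybar ubar d y : 'rV[R]_m) :
  proper g -> econvex g -> C2_cone_reducible g -> subdifferential g ybar ubar ->
  lin [set d | subderivative g ybar d = (dot ubar d)%:E] d ->
  coderivative (subdifferential g) ybar ubar 0 y -> dot y d <= 0.
Proof.
move=> pg cg red sbar [/= subd [dN subdN dE]] [z_ [v_ [cz gz reg cv]]].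
have gy : g ybar \is a fin_num by case: sbar.
have subNd : subderivative g ybar (- d) = (dot ubar (- d))%:E by rewrite -dE opprK.
have dom : effective_domain g ybar by rewrite /effective_domain/= ltey_eq gy.
have [q [B [q0 B0 bound]]] :=
  regular_normal_bound pg (epigraph_segment_closed pg cg) gy (red _ dom) subd subNd.
pose L := 1 + m%:R * (`|ubar| + 1).
have L1 : 1 <= L by rewrite lerDl mulr_ge0// addr_ge0.
pose K := B * ((`|y| + 1) * L + 1) + m%:R * `|d|.
have K0 : 0 <= K by rewrite addr_ge0// mulr_ge0// addr_ge0// mulr_ge0 ?addr_ge0//; lra.
apply: (@le0_of_small _ _ K 1) => // e e0 e1.
(* The second bound puts the epigraph point within [q]; [eta < 1], inherited from [e], gives the
   bounds on [uk] and [a]. *)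
pose eta := Num.min e (q / L).
have eta0 : 0 < eta by rewrite lt_min e0 divr_gt0//; lra.
have etae : eta <= e by rewrite ge_min lexx.
have etaq : eta * L <= q by rewrite -ler_pdivlMr ?ge_min ?lexx ?orbT//; lra.
have hz : \forall k \near \oo, `|row_mx ybar ubar - z_ k| < eta.
  by move/cvgrPdist_lt : cz; exact.
have hv : \forall k \near \oo, `|row_mx y (- 0) - v_ k| < eta.
  by move/cvgrPdist_lt : cv; exact.
have [k [/ltW zk /ltW vk]] := filter_ex (filterI hz hv).
move: zk vk (gz k) (reg k); rewrite -[z_ k]hsubmxK -[v_ k]hsubmxK.
move: (lsubmx (z_ k)) (rsubmx (z_ k)) (lsubmx (v_ k)) (rsubmx (v_ k)) => yk uk a b.
rewrite !opp_row_mx !add_row_mx !norm_row_mx_le => /andP[dy du] /andP[da].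
rewrite oppr0 sub0r normrN => db; rewrite /graph_of/= row_mxKl row_mxKr => suk regk.
have ukV : `|uk| <= `|ubar| + 1.
  rewrite -[uk](subrK ubar) (le_trans (ler_normD _ _))// addrC lerD2l distrC; lra.
have Zd : `|row_mx yk (fine (g yk))%:M - row_mx ybar (fine (g ybar))%:M| <= eta * L.
  rewrite (le_trans (subgradient_value_lipschitz sbar suk ukV))// mulrC.
  by rewrite -/L ler_wpM2r ?(le_trans ler01 L1)// distrC.
have := bound _ _ _ _ suk ukV (le_trans Zd etaq) regk.
have aV : `|a| <= `|y| + 1.
  rewrite -[a](subrK y) (le_trans (ler_normD _ _))// addrC lerD2l distrC; lra.
have h1 : `|a| * `|row_mx yk (fine (g yk))%:M - row_mx ybar (fine (g ybar))%:M| + `|b| <=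
   (`|y| + 1) * (eta * L) + eta by rewrite lerD// ler_pM.
move=> /le_trans/(_ (ler_wpM2l B0 h1)) h2.
have h3 : dot (y - a) d <= m%:R * eta * `|d|.
  rewrite (le_trans (ler_norm _))// (le_trans (norm_dot_le _ _))//.
  by rewrite ler_wpM2r// ler_wpM2l.
have -> : dot y d = dot a d + dot (y - a) d by rewrite dotBl addrCA subrr addr0.
have : K * eta <= K * e by rewrite ler_wpM2l.
rewrite {1}/K; lra.
Qed.

Theorem theorem4p1 (R : realType) (n m : nat)
    (h : 'rV[R]_n -> R) (F : 'rV[R]_n -> 'rV[R]_m) (g : 'rV[R]_m -> \bar R)
    (xbar : 'rV[R]_n) (ubar : 'rV[R]_m)
    (h_C2 : C2_on [set: 'rV[R]_n] h) (F_C2 : C2_on [set: 'rV[R]_n] F)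
    (g_proper : proper g) (g_lsc : lower_semicontinuous g) (g_convex : econvex g)
    (kkt : KKT h F g xbar ubar)
    (nondegenerate : constraint_nondegenerate F g xbar ubar)
    (g_reducible : C2_cone_reducible g) :
  second_order_qualification F g xbar ubar.
Proof.
have decomp y : exists v b, y = v *m jacobian F xbar + b /\
    lin [set d | subderivative g (F xbar) d = (dot ubar d)%:E] b.
  have : [set: 'rV[R]_m] y by [].
  rewrite -nondegenerate => -[_ [v _ <-] [b linb <-]]; exists v, b; split => //.
  have [dF _ _] := F_C2 xbar I.
  by rewrite -deriveEjacobian// deriveE.
have gfin : g (F xbar) \is a fin_num.
  by have [_ [b [_ [subd _]]]] := decomp 0; exact: subderivative_fin_num subd.
have sub : subdifferential g (F xbar) ubar.
  apply: subdifferential_conjugate => //.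
  by have [_ [w subw /eqP]] := kkt; rewrite subr_eq0 => /eqP <-.
apply/seteqP; split => [y [/= yJ coder]|_ ->].
  have [v [b [yE linb]]] := decomp y.
  (* Decomposing [y] itself, its part in the range of the derivative of [F] is orthogonal to [y], so
     [dot y y = dot y b], which is at most 0 by polarity. *)
  apply: dot_eq0; apply/eqP; rewrite eq_le dot_ge0 andbT {2}yE dotDr.
  rewrite [dot y _]dotC dot_mulmx yJ dot0r add0r.
  exact: coderivative_subdifferential_polar coder.
split; first by rewrite /= mul0mx.
(* The zero vector is a limiting normal through constant sequences, as (F xbar, ubar) lies in the
   graph. *)
exists (fun=> row_mx (F xbar) ubar), (fun=> row_mx 0 (- 0)); split => [|k|k|].
- exact: cvg_cst.
- by rewrite /graph_of/= row_mxKl row_mxKr.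
- move=> e e0; apply: nearW => z _.
  by rewrite oppr0 row_mx0 dotC dot0r mulr_ge0// ltW.
- exact: cvg_cst.
Qed.
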